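(* Let $R=(r_j)_{j\ge0}$ be an $\Re$-Leja sequence on $[-1,1]$, let $n\ge0$ and $k$ be integers with $2^n<k-1<2^{n+1}$, and let $l:=k-(2^n+1)$, so that $0<l<2^n$. Then $$\mathbb{L}_{R_k}\le 6\sqrt5\; 2^{\,n+\sigma_1(l)-p(l)}\;\mathbb{L}_{2^{p(l)}} .$$
   Context: $\mathcal{U}=\{z\in\mathbb{C}:|z|\le 1\}$. A Leja sequence on $\mathcal{U}$ initiated at $1$ is a sequence $(e_j)_{j\ge0}$ such that $e_0=1$ and, for every $k\ge1$, $e_k$ is one of the maximizers over $z\in\mathcal{U}$ of $|z-e_{k-1}|\cdots|z-e_0|$. An $\Re$-Leja sequence $R=(r_j)_{j\ge0}$ on $[-1,1]$ is the sequence obtained from such an $E$ by projecting onto the real axis without repetition: $J(0)=0$, $r_0=\Re(e_0)=1$, and for $k\ge1$, $r_k=\Re(e_{J(k)})$ where $J(k)=\min\{j>J(k-1):\Re(e_j)\notin R_k\}$ and $R_k=(r_0,\dots,r_{k-1})$. For a compact $X$ and a finite tuple $S=(s_0,\dots,s_{k-1})$ of mutually distinct points of $X$, with Lagrange polynomials $l_j(z)=\prod_{0\le i\le k-1,\ i\ne j}\frac{z-s_i}{s_j-s_i}$, the Lebesgue constant of $S$ on $X$ is $\max_{z\in X}\sum_{j=0}^{k-1}|l_j(z)|$. Here $\mathbb{L}_{R_k}$ is the Lebesgue constant of $R_k$ on $X=[-1,1]$, and for $p\ge0$, $\mathbb{L}_{2^p}$ is the Lebesgue constant of the set of $2^p$-th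 roots of unity on $X=\mathcal{U}$. (It is known that $\mathbb{L}_1=1$, $\mathbb{L}_2=\sqrt2$ and $\mathbb{L}_{2^p}\le\frac2\pi\big(\log(2^p)+\frac94\big)$ for $p\ge2$.) For an integer $m\ge1$, $\sigma_1(m)$ is the number of ones in the binary expansion of $m$, and $p(m)$ is the largest integer $p$ such that $2^p$ divides $m$. *)

(* Defs.v *)
From mathcomp Require Export all_boot all_order all_algebra.
From mathcomp Require Export complex.
From mathcomp Require Export boolp classical_sets set_interval reals trigo.

Set Implicit Arguments.
Unset Strict Implicit.
Unset Printing Implicit Defensive.

Import Order.TTheory GRing.Theory Num.Theory.
Import ComplexField.Normc.

Local Open Scope classical_set_scope.
Local Open Scope complex_scope.
Local Open Scope ring_scope.

Section Interpolation.
Variable R : realType.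

Definition unit_disc : set R[i] := [set z | normc z <= 1].

(* [-1, 1], seen as a subset of the complex plane *)
Definition real_segment : set R[i] := [set x%:C | x in `[-1, 1]].

Definition lagrange (S : seq R[i]) (j : 'I_(size S)) (z : R[i]) : R[i] :=
  \prod_(i < size S | i != j) ((z - S`_i) / (S`_j - S`_i)).

(* For X nonempty and compact the Lebesgue function z |-> \sum_j |l_j(z)| is
   continuous on X, so the supremum is a maximum. *)
Definition lebesgue_constant (X : set R[i]) (S : seq R[i]) : R :=
  sup [set \sum_(j < size S) normc (lagrange j z) | z in X].

Definition unity_roots (N : nat) : seq R[i] :=
  mkseq (fun j => let t := 2 * pi * j%:R / N%:R in cos t +i* sin t) N.

Definition leja (e : nat -> R[i]) : Prop :=
  e 0%N = 1 /\
  forall k, (0 < k)%N ->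
    unit_disc (e k) /\
    forall z, unit_disc z ->
      \prod_(j < k) normc (z - e j) <= \prod_(j < k) normc (e k - e j).

(* [mkseq r k.+1] is the tuple (r_0, ..., r_k); the last two clauses say that
   J k.+1 is the least j > J k with Re (e j) outside it. *)
Definition projects_to (e : nat -> R[i]) (J : nat -> nat) (r : nat -> R) :
    Prop :=
  [/\ J 0%N = 0%N,
      forall k, r k = complex.Re (e (J k)),
      forall k, (J k < J k.+1)%N /\
                complex.Re (e (J k.+1)) \notin mkseq r k.+1 &
      forall k j, (J k < j)%N -> complex.Re (e j) \notin mkseq r k.+1 ->
                  (J k.+1 <= j)%N].

Definition Re_leja (r : nat -> R) : Prop :=
  exists e J, leja e /\ projects_to e J r.

Definition lebesgue_Re (r : nat -> R) (k : nat) : R :=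
  lebesgue_constant real_segment [seq x%:C | x <- mkseq r k].

Definition lebesgue_unity (N : nat) : R :=
  lebesgue_constant unit_disc (unity_roots N).

End Interpolation.

(* Since m < 2 ^ m, the binary digits of m of index at least m vanish. *)
Definition sigma1 (m : nat) : nat := (\sum_(i < m) odd (m %/ 2 ^ i))%N.

Definition two_val (m : nat) : nat := logn 2 m.

(* Main.v *)
Require Import Defs.
From mathcomp Require Import zify ring lra.
Import Order.TTheory GRing.Theory Num.Theory.
Import ComplexField.Normc.

Set Implicit Arguments.
Unset Strict Implicit.
Unset Printing Implicit Defensive.

Local Open Scope complex_scope.
Local Open Scope ring_scope.
#[local] Arguments normc : simpl never.

(** Write [N = 2 ^ n], [K = 2N + l], let [E = {e_0, ..., e_(K-1)}] be the
    first [K] terms of the Leja sequence and [c = e_K] its next term.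

    Leja sequences are governed by binary expansions: the nodal polynomial of
    the first [k] terms is the product of [z ^ 2^i + c ^ 2^i] over the positions
    [i] of the binary digits one of [k], where [c] is the next term
    ([leja_nodal]).  In particular
    [E] is the union of the [2N]-th roots of unity [U] and of a set [C] of [l]
    points whose nodal modulus [W] is given by the digits of [l]; moreover
    [c ^ (2N) = -1].

    Projection.  The real nodes are the real parts of [U] and [C].  For
    [x = Re z] with [z] on the unit circle, [|x - Re a|] is half of
    [|z - a| |conj z - a|], and collecting these factors bounds the Lagrange
    polynomial of the node [Re b] by
    [|l_b z| W(conj z) / W(conj b) + |l_b (conj z)| W(z) / W(conj b)], with [l_b]
    the Lagrange polynomial of [b] in [E] ([half_ratio]).  So it suffices to
    bound the sum over [b] in [E] of [|l_b z| W(w) / W(conj b)] for [z], [w] on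
    the circle ([weighted_sum]).

    Removing the factor [2 ^ p].  When [2 ^ p] divides [l], all these node sets
    are unions of cosets of the [2 ^ p]-th roots of unity, the weights only
    depend on [b ^ 2^p], and the sum over one coset is a value of the Lebesgue
    function of the roots of unity.  This costs the factor [L_(2^p)] and
    reduces the question to odd [l] ([sum_lag_iter_lift]).

    Odd [l].  The inequality [x y <= (t x^2 + y^2 / t) / 2] separates the
    two factors.  The sum of the [1 / W(v)^2] over a coset of roots of unity
    can be computed exactly ([sum_inv_nodal]), and two such cosets contain all
    the [conj b] ([sum_inv_nodal_conj]): a pair of opposite nodes is summed by the parallelogram
    identity, which replaces the variable by its square and strips one binary
    digit.  The sum of the [|l_b|^2], the quadratic Lebesgue function, is at
    most [6 * 2 ^ sigma] where [sigma] is the number of binary digits one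
    ([quadratic_lebesgue]).  Its proof strips binary digits in the same way; the
    induction closes because it is carried out for the weighted sums of
    [|l_b z|^2 (al + be |z - b|^2 / |c - b|^2)].  A zero digit preserves such
    weights, and a digit one turns [al, be] into [3/2 al, 2 be + 3 al]: the
    growth rate [3/2] of [al] being less than [2], the total grows like
    [2 ^ sigma].  The constants multiply to [44 <= 24 sqrt 5]. *)

(** * Finite lists *)

Lemma perm_of_sub (T : eqType) (s1 s2 : seq T) : uniq s1 -> uniq s2 ->
  {subset s1 <= s2} -> (size s2 <= size s1)%N -> perm_eq s1 s2.
Proof. by move=> u1 u2 sub sz; apply: uniq_perm => //; have [] := uniq_min_size u1 sub sz. Qed.

Lemma ler_sum_sub (R : numDomainType) (T : eqType) (s1 s2 : seq T) (F : T -> R) :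
  uniq s1 -> uniq s2 -> {subset s1 <= s2} -> (forall x, 0 <= F x) ->
  \sum_(x <- s1) F x <= \sum_(x <- s2) F x.
Proof.
move=> u1 u2 sub F0.
have P : perm_eq [seq x <- s2 | x \in s1] s1.
  apply: uniq_perm => //; first exact: filter_uniq.
  by move=> x; rewrite mem_filter; case: (boolP (x \in s1)) => // /sub ->.
rewrite -(perm_big _ P) /= big_filter big_mkcond; apply: ler_sum => x _.
by case: ifP.
Qed.

(** Cancelling [x] and [f x] as list elements, rather than as factors of a
    product, keeps the resulting product identities valid where those factors
    vanish. *)
Lemma perm_rem_map (T : eqType) (f : T -> T) (s s1 s2 s3 : seq T) x :
  perm_eq (s ++ map f s) (s1 ++ s2 ++ s3) -> x \in s -> x \in s2 ->
  perm_eq (f x :: (rem x s ++ map f (rem x s))) (s1 ++ rem x s2 ++ s3).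
Proof.
move=> p xs xs2; have pJ := perm_map f (perm_to_rem xs).
apply/permP => q; have := permP p q; rewrite !count_cat.
have -> : count q s = (q x + count q (rem x s))%N := permP (perm_to_rem xs) q.
have -> : count q s2 = (q x + count q (rem x s2))%N := permP (perm_to_rem xs2) q.
have -> : count q (map f s) = (q (f x) + count q (map f (rem x s)))%N := permP pJ q.
rewrite -cat1s !count_cat /= addn0.
move: (nat_of_bool _) (nat_of_bool _).
move: (count _ _) (count _ _) (count _ _) (count _ _) (count _ _); lia.
Qed.

(** * Modulus of complex numbers *)

Section Modulus.
Variable R : realType.
Implicit Types z w u v a b c : R[i].

Lemma normc_ge0 z : 0 <= normc z.
Proof. by case: z => a b; rewrite /normc sqrtr_ge0. Qed.

Lemma normc_eq0 z : (normc z == 0) = (z == 0).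
Proof. by apply/eqP/eqP => [/eq0_normc//|->]; rewrite normc0. Qed.

Lemma normc_gt0 z : (0 < normc z) = (z != 0).
Proof. by rewrite lt_neqAle normc_ge0 andbT eq_sym normc_eq0. Qed.

Lemma normcE2 z : normc z ^+ 2 = complex.Re z ^+ 2 + complex.Im z ^+ 2.
Proof. by case: z => a b; rewrite /normc sqr_sqrtr ?addr_ge0 ?sqr_ge0. Qed.

Lemma normc_opp z : normc (- z) = normc z.
Proof. by case: z => a b; rewrite /normc /= !sqrrN. Qed.

Lemma normc_conj z : normc (conjc z) = normc z.
Proof. by case: z => a b; rewrite /normc /= sqrrN. Qed.

Lemma normc_exp z k : normc (z ^+ k) = normc z ^+ k.
Proof. by elim: k => [|k IH]; rewrite ?expr0 ?normc1// !exprS normcM IH. Qed.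

Lemma normc_prod (I : Type) (s : seq I) (P : pred I) (F : I -> R[i]) :
  normc (\prod_(i <- s | P i) F i) = \prod_(i <- s | P i) normc (F i).
Proof. exact: (big_morph _ (@normcM R) (normc1 R)). Qed.

Lemma ler_normcD z w : normc (z + w) <= normc z + normc w.
Proof. exact: le_normcD. Qed.

Lemma ler_normcB z w : normc (z - w) <= normc z + normc w.
Proof. by rewrite -(normc_opp w) ler_normcD. Qed.

Lemma normc_real (x : R) : normc (x%:C) = `|x|.
Proof. by rewrite /normc /= expr0n /= addr0 sqrtr_sqr. Qed.

Lemma normc_double c : normc c = 1 -> normc (c + c) = 2.
Proof.
move=> c1; rewrite (_ : c + c = (2 : R)%:C * c); last by rewrite rmorph_nat mulr_natl.
by rewrite normcM c1 mulr1 normc_real ger0_norm.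
Qed.

Lemma normc_parallelogram u v :
  normc (u + v) ^+ 2 + normc (u - v) ^+ 2 = 2 * (normc u ^+ 2 + normc v ^+ 2).
Proof. by case: u => a b; case: v => c d; rewrite !normcE2 /=; ring. Qed.

Lemma normc_addsub2 (u v : R[i]) : normc u = 1 -> normc v = 1 ->
  normc (u + v) ^+ 2 + normc (u - v) ^+ 2 = 4.
Proof. by move=> u1 v1; rewrite normc_parallelogram u1 v1; ring. Qed.

(** Equality case of the triangle inequality, from the parallelogram
    identity. *)
Lemma normcD_eq2 z w :
  normc z <= 1 -> normc w = 1 -> 2 <= normc (z + w) -> z = w.
Proof.
move=> z1 w1 h; apply/eqP; rewrite -subr_eq0 -normc_eq0 -sqrf_eq0.
have := normc_parallelogram z w; rewrite w1 => e.
have := normc_ge0 z => z0.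
have : normc z ^+ 2 <= 1 by rewrite expr_le1.
have : 2 ^+ 2 <= normc (z + w) ^+ 2 by rewrite lerXn2r ?nnegrE ?normc_ge0.
have := sqr_ge0 (normc (z - w)).
by move=> h1 h2 h3; rewrite eq_le; apply/andP; split; nra.
Qed.

Lemma normc_sqrt z : normc z = 1 -> normc (sqrtc z) = 1.
Proof.
move=> z1; have /eqP : normc (sqrtc z) ^+ 2 = 1 by rewrite -normc_exp sqr_sqrtc.
by rewrite sqrp_eq1 ?normc_ge0// => /eqP.
Qed.

Lemma circle_neq0 z : normc z = 1 -> z != 0.
Proof. by move=> h; rewrite -normc_gt0 h. Qed.

Lemma conjc_circle c : normc c = 1 -> conjc c = c^-1.
Proof.
move=> c1; have c0 := circle_neq0 c1.
apply: (mulfI c0); rewrite mulfV//.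
case: c c1 {c0} => a b /(congr1 (fun x => x ^+ 2)); rewrite normcE2 /= expr1n => h.
by apply/eqP; rewrite eq_complex /=; apply/andP; split; apply/eqP; [rewrite -h|]; ring.
Qed.

Lemma conjcI : injective (@conjc R).
Proof. exact: (can_inj (@conjcK R)). Qed.

Lemma Im_conjc a : complex.Im (conjc a) = - complex.Im a.
Proof. by case: a. Qed.

Lemma Re_conjc a : complex.Re (conjc a) = complex.Re a.
Proof. by case: a. Qed.

Lemma conjc_fix a : (conjc a == a) = (complex.Im a == 0).
Proof.
case: a => x y; rewrite eq_complex /= eqxx /=.
by rewrite -subr_eq0 -opprD oppr_eq0 -mulr2n mulrn_eq0.
Qed.

Lemma circle_Re a b : normc a = 1 -> normc b = 1 -> complex.Re a = complex.Re b ->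
  a = b \/ a = conjc b.
Proof.
move=> a1 b1 e.
have : complex.Im a ^+ 2 == complex.Im b ^+ 2.
  have := normcE2 a; have := normcE2 b; rewrite a1 b1 e => h1 h2.
  by apply/eqP; lra.
rewrite eqf_sqr => /orP[]/eqP; case: a b e {a1 b1} => [x y] [u v] /= -> ->; by [left|right].
Qed.

Lemma circle_real a : normc a = 1 -> complex.Im a = 0 -> a = 1 \/ a = -1.
Proof.
case: a => x y a1 /= y0; have := normcE2 (x +i* y); rewrite a1 /= y0 expr0n addr0 expr1n.
move/esym/eqP; rewrite sqrf_eq1 => /orP[]/eqP ->; first by left.
by right; apply/eqP; rewrite eq_complex /= oppr0 !eqxx.
Qed.

Lemma Im_1 : complex.Im (1 : R[i]) = 0. Proof. by []. Qed.
Lemma Im_N1 : complex.Im (-1 : R[i]) = 0. Proof. by rewrite /= oppr0. Qed.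

Lemma one_neqN1 : (1 : R[i]) != -1.
Proof. by rewrite -subr_eq0 opprK -mulr2n pnatr_eq0. Qed.

(** On the circle [z^2 - 1 = z (z - 1/z)] and [1/z] is the conjugate. *)
Lemma normc_sqrB1 z : normc z = 1 ->
  normc (z - 1) * normc (z + 1) = normc (z - conjc z).
Proof.
move=> z1; have z0 := circle_neq0 z1.
rewrite -normcM -[RHS]mul1r -z1 -normcM conjc_circle//; congr normc.
by field.
Qed.

Lemma normc_conj_sub z a : normc (z - conjc a) = normc (conjc z - a).
Proof. by rewrite -normc_conj rmorphB /= conjcK. Qed.

(** On the circle [(z - a) (z - conj a) = 2 z (Re z - Re a)]. *)
Lemma Re_dist z a : normc z = 1 -> normc a = 1 ->
  normc ((complex.Re z)%:C - (complex.Re a)%:C) =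
  normc (z - a) * normc (conjc z - a) / 2.
Proof.
move=> z1 a1; have z0 := circle_neq0 z1; have a0 := circle_neq0 a1.
rewrite -normc_conj_sub -normcM.
have -> : (z - a) * (z - conjc a) =
    z * ((2 : R)%:C * ((complex.Re z)%:C - (complex.Re a)%:C)).
  have := addcJ z; have := addcJ a; rewrite rmorph_nat [2 * (_ - _)]mulrBr => <- <-.
  by rewrite !conjc_circle//; field; rewrite ?z0 ?a0.
rewrite !normcM z1 mul1r normc_real ger0_norm //; by field.
Qed.

End Modulus.

(** * Iterated square roots of lists of nodes *)

Section SquareRoots.
Variable R : realType.
Implicit Types (z w s b : R[i]) (A : seq R[i]).

Definition lift A : seq R[i] := flatten [seq [:: sqrtc s; - sqrtc s] | s <- A].

Lemma lift_cons s A : lift (s :: A) = sqrtc s :: - sqrtc s :: lift A.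
Proof. by []. Qed.

Lemma lift_cat A B : lift (A ++ B) = lift A ++ lift B.
Proof. by rewrite /lift map_cat flatten_cat. Qed.

Lemma mem_sqroots z s : (z \in [:: sqrtc s; - sqrtc s]) = (z ^+ 2 == s).
Proof.
by rewrite !inE -{3}(sqr_sqrtc s) -subr_eq0 -(subr_eq0 (_ ^+ 2)) subr_sqr mulf_eq0
           subr_eq0 addr_eq0.
Qed.

Lemma sqrt_cases s b : b ^+ 2 = s -> b = sqrtc s \/ b = - sqrtc s.
Proof. by move/eqP; rewrite -mem_sqroots !inE => /orP[]/eqP; [left|right]. Qed.

Lemma mem_lift z A : (z \in lift A) = (z ^+ 2 \in A).
Proof.
elim: A => [|s A IH] //; rewrite lift_cons -[_ :: _ :: _]/([:: _; _] ++ _).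
by rewrite mem_cat mem_sqroots IH inE.
Qed.

Lemma big_lift (T : Type) (idx : T) (op : Monoid.law idx) A (F : R[i] -> T) :
  \big[op/idx]_(a <- lift A) F a =
  \big[op/idx]_(s <- A) op (F (sqrtc s)) (F (- sqrtc s)).
Proof.
elim: A => [|s A IH]; first by rewrite !big_nil.
by rewrite lift_cons !big_cons IH Monoid.mulmA.
Qed.

Lemma size_lift A : size (lift A) = (size A).*2.
Proof. by elim: A => //= s A ->. Qed.

Lemma sqrtc_neqN s : s != 0 -> sqrtc s != - sqrtc s.
Proof.
move=> s0; rewrite -subr_eq0 opprK -mulr2n mulrn_eq0 /=.
by apply: contra s0 => /eqP h; rewrite -(sqr_sqrtc s) h expr0n.
Qed.

Lemma lift_uniq A : 0 \notin A -> uniq A -> uniq (lift A).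
Proof.
elim: A => [|s A IH] //; rewrite inE negb_or eq_sym => /andP[s0 A0].
rewrite lift_cons !cons_uniq => /andP[sA uA].
rewrite inE negb_or sqrtc_neqN //= !mem_lift sqrrN sqr_sqrtc sA /=.
exact: IH.
Qed.

Lemma lift_circle A :
  {in A, forall s, normc s = 1} -> {in lift A, forall s, normc s = 1}.
Proof.
move=> h z; rewrite mem_lift => /h; rewrite normc_exp => /eqP.
by rewrite sqrp_eq1 ?normc_ge0// => /eqP.
Qed.

Definition roots2 m s := iter m lift [:: s].

Lemma mem_iter_lift m A z : (z \in iter m lift A) = (z ^+ (2 ^ m) \in A).
Proof.
elim: m z => [|m IH] z; first by rewrite expn0 expr1.
by rewrite iterS mem_lift IH -exprM -expnS.
Qed.

Lemma mem_roots2 m s z : (z \in roots2 m s) = (z ^+ (2 ^ m) == s).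
Proof. by rewrite mem_iter_lift inE. Qed.

Lemma iter_lift0 m A : 0 \notin A -> 0 \notin iter m lift A.
Proof. by move=> A0; rewrite mem_iter_lift expr0n expn_eq0. Qed.

Lemma iter_lift_uniq m A : 0 \notin A -> uniq A -> uniq (iter m lift A).
Proof.
move=> A0 uA; elim: m => //= m IH.
by rewrite lift_uniq// iter_lift0.
Qed.

Lemma iter_lift_cat m A B :
  iter m lift (A ++ B) = iter m lift A ++ iter m lift B.
Proof. by elim: m => //= m ->; rewrite lift_cat. Qed.

Lemma sum_iter_lift p A (F : R[i] -> R) :
  \sum_(b <- iter p lift A) F b = \sum_(s <- A) \sum_(b <- roots2 p s) F b.
Proof.
elim: A => [|s A IH].
  by rewrite (_ : iter p _ _ = [::]) ?big_nil//; elim: p => //= p ->.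
by rewrite -cat1s iter_lift_cat big_cat IH big_cons.
Qed.

Lemma size_iter_lift m A : size (iter m lift A) = (2 ^ m * size A)%N.
Proof. by elim: m => [|m IH]; rewrite ?mul1n// iterS size_lift IH -mul2n expnS mulnA. Qed.

Lemma roots2_uniq m s : s != 0 -> uniq (roots2 m s).
Proof. by move=> s0; rewrite iter_lift_uniq// inE eq_sym. Qed.

Lemma size_roots2 m s : size (roots2 m s) = (2 ^ m)%N.
Proof. by rewrite size_iter_lift muln1. Qed.

Lemma iter_lift_circle m A :
  {in A, forall s, normc s = 1} -> {in iter m lift A, forall s, normc s = 1}.
Proof. by move=> h; elim: m => //= m IH; exact: lift_circle. Qed.

Lemma roots2_circle m s : normc s = 1 -> {in roots2 m s, forall a, normc a = 1}.
Proof. by move=> s1; apply: iter_lift_circle => a; rewrite inE => /eqP->. Qed.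

Lemma prod_lift_sub A z : \prod_(a <- lift A) (z - a) = \prod_(s <- A) (z ^+ 2 - s).
Proof.
rewrite big_lift; apply: eq_bigr => s _ /=.
by rewrite -{3}(sqr_sqrtc s); ring.
Qed.

Lemma perm_conj_roots2 m s : s != 0 ->
  perm_eq [seq conjc a | a <- roots2 m s] (roots2 m (conjc s)).
Proof.
move=> s0; apply: perm_of_sub.
- by rewrite map_inj_uniq ?roots2_uniq//; exact: (can_inj (@conjcK R)).
- by rewrite roots2_uniq// conjc_eq0.
- move=> _ /mapP[a ha ->]; rewrite mem_roots2 -rmorphXn /=.
  by move: ha; rewrite mem_roots2 => /eqP ->.
- by rewrite size_map !size_roots2.
Qed.

End SquareRoots.

(** * Nodal polynomials prescribed by binary digits *)

Section Nodal.
Variable R : realType.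
Implicit Types (z w c d : R[i]) (bs : seq bool).

(** The digits in [bs] are listed from the least significant one, so that the
    polynomial is the product of the [z ^ 2^i + c ^ 2^i] over the positions [i]
    of the true digits. *)
Fixpoint nodal bs z c : R[i] :=
  if bs is b :: bs' then (if b then z + c else 1) * nodal bs' (z ^+ 2) (c ^+ 2)
  else 1.

(** The roots of [nodal bs z c] in [z], listed along the same recursion: a digit
    one contributes [- c], and the other roots are the square roots of the
    nodes attached to [c ^+ 2]. *)
Fixpoint nodes bs c : seq R[i] :=
  if bs is b :: bs' then (if b then [:: - c] else [::]) ++ lift (nodes bs' (c ^+ 2))
  else [::].

Lemma prod_nodes bs z c : \prod_(a <- nodes bs c) (z - a) = nodal bs z c.
Proof.
elim: bs z c => [|b bs IH] z c /=; first by rewrite big_nil.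
rewrite big_cat /= prod_lift_sub IH.
by case: b; rewrite ?big_cons big_nil ?mulr1 ?opprK.
Qed.

Lemma normc_nodal_le bs z c : normc z <= 1 -> normc c = 1 ->
  normc (nodal bs z c) <= 2 ^+ count id bs.
Proof.
elim: bs z c => [|b bs IH] z c z1 c1 /=; first by rewrite normc1 expr0.
have h := IH (z ^+ 2) (c ^+ 2).
rewrite !normc_exp c1 expr1n expr_le1 ?normc_ge0// in h.
rewrite normcM exprD; apply: ler_pM; rewrite ?normc_ge0 ?h//.
case: b => /=; rewrite ?normc1// expr1.
by apply: le_trans (ler_normcD _ _) _; rewrite c1; lra.
Qed.

Lemma normc_nodal_diag bs c : normc c = 1 ->
  normc (nodal bs c c) = 2 ^+ count id bs.
Proof.
elim: bs c => [|b bs IH] c c1 /=; first by rewrite normc1 expr0.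
rewrite normcM IH ?normc_exp ?c1 ?expr1n// exprD; congr (_ * _).
by case: b => /=; rewrite ?normc1 ?normc_double ?expr0.
Qed.

(** Each factor [z ^ 2^i + c ^ 2^i] has modulus at most 2, so a maximizer [z]
    must satisfy [z ^ 2^i = c ^ 2^i] at every true digit, and then [c] can be
    replaced by [z] in the nodal polynomial. *)
Lemma nodal_max bs z c : normc z <= 1 -> normc c = 1 ->
  2 ^+ count id bs <= normc (nodal bs z c) ->
  (forall w, nodal bs w z = nodal bs w c) /\ (has id bs -> normc z = 1).
Proof.
elim: bs z c => [|b bs IH] z c z1 c1 //= h.
have z1' : normc (z ^+ 2) <= 1 by rewrite normc_exp expr_le1 ?normc_ge0.
have c1' : normc (c ^+ 2) = 1 by rewrite normc_exp c1 expr1n.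
move: h (normc_nodal_le bs z1' c1'); case: b => /=; last first.
  rewrite add0n !mul1r => h _; have [eN e1] := IH _ _ z1' c1' h.
  split=> [w|/e1 /eqP]; first by rewrite eN.
  by rewrite normc_exp sqrp_eq1 ?normc_ge0// => /eqP.
rewrite normcM (exprS (2 : R)) => h1 h2.
have p : 0 < (2 : R) ^+ count id bs by rewrite exprn_gt0.
have h3 : 2 <= normc (z + c).
  rewrite -(ler_pM2r p); apply: le_trans h1 _.
  by rewrite ler_wpM2l ?normc_ge0.
by rewrite (normcD_eq2 z1 c1 h3).
Qed.

Lemma count_rcons bs (b : bool) : count id (rcons bs b) = (count id bs + b)%N.
Proof. by rewrite -cats1 count_cat /= addn0. Qed.

Lemma nodal_rcons bs b z c :
  nodal (rcons bs b) z c =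
  nodal bs z c * (if b then z ^+ (2 ^ size bs) + c ^+ (2 ^ size bs) else 1).
Proof.
elim: bs z c => [|b' bs IH] z c /=; first by rewrite mul1r mulr1 !expn0 !expr1.
by rewrite IH mulrA -!exprM -expnS.
Qed.

Lemma nodes_rcons0 bs c : nodes (rcons bs false) c = nodes bs c.
Proof. by elim: bs c => [|b bs IH] c //=; rewrite IH. Qed.

Lemma nodes_rcons bs c :
  nodes (rcons bs true) c = nodes bs c ++ roots2 (size bs) (- c ^+ (2 ^ size bs)).
Proof.
elim: bs c => [|b' bs IH] c /=; first by rewrite expn0 expr1.
by rewrite IH lift_cat catA -!exprM -expnS.
Qed.

Lemma nodal_shift p bs z c :
  nodal (nseq p false ++ bs) z c = nodal bs (z ^+ (2 ^ p)) (c ^+ (2 ^ p)).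
Proof.
elim: p z c => [|p IH] z c; first by rewrite expn0 !expr1.
by rewrite /= mul1r IH -!exprM -expnS.
Qed.

Lemma nodes_shift p bs c :
  nodes (nseq p false ++ bs) c = iter p (@lift R) (nodes bs (c ^+ (2 ^ p))).
Proof.
elim: p c => [|p IH] c; first by rewrite expn0 !expr1.
by rewrite /= IH -!exprM -expnS.
Qed.

Lemma nodes_circle bs c : normc c = 1 -> {in nodes bs c, forall s, normc s = 1}.
Proof.
elim: bs c => [|b bs IH] c c1 // z; rewrite /= mem_cat => /orP[|].
  by case: b => //; rewrite inE => /eqP->; rewrite normc_opp.
apply: lift_circle => s; apply: IH.
by rewrite normc_exp c1 expr1n.
Qed.

Lemma nodes_neq0 bs c : normc c = 1 -> 0 \notin nodes bs c.
Proof.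
move=> c1; apply/negP => /(nodes_circle c1) h; have := circle_neq0 h.
by rewrite eqxx.
Qed.

Lemma nodes_pow bs c a : normc c = 1 -> a \in nodes bs c ->
  a ^+ (2 ^ size bs) = c ^+ (2 ^ size bs).
Proof.
elim: bs c a => [|b bs IH] c a c1 //=; rewrite mem_cat => /orP[|].
  by case: b => //; rewrite inE => /eqP->; rewrite expnS !exprM sqrrN.
by rewrite mem_lift expnS !exprM => /IH->//; rewrite normc_exp c1 expr1n.
Qed.

Lemma nodes_notin bs c : normc c = 1 -> c \notin nodes bs c.
Proof.
move=> c1; apply/negP => h.
have : normc (nodal bs c c) = 0.
  by rewrite -prod_nodes (perm_big _ (perm_to_rem h)) /= big_cons subrr mul0r normc0.
rewrite normc_nodal_diag// => /eqP; rewrite expf_eq0 pnatr_eq0 andbF //.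
Qed.

Lemma nodes_uniq bs c : normc c = 1 -> uniq (nodes bs c).
Proof.
elim: bs c => [|b bs IH] c c1 //=.
have c1' : normc (c ^+ 2) = 1 by rewrite normc_exp c1 expr1n.
have u : uniq (lift (nodes bs (c ^+ 2))) by rewrite lift_uniq ?nodes_neq0 ?IH.
by case: b; rewrite /= ?u// mem_lift sqrrN nodes_notin.
Qed.

End Nodal.

(** * Binary digits *)

Definition digits n k := mkseq (fun i => odd (k %/ 2 ^ i)) n.

Lemma size_digits n k : size (digits n k) = n.
Proof. exact: size_mkseq. Qed.

Lemma digitsS n k : digits n.+1 k = odd k :: digits n k./2.
Proof.
rewrite /digits /mkseq /= expn0 divn1; congr cons.
rewrite (iotaDl 1 0) -map_comp; apply: eq_map => i /=.
by rewrite -divn2 -divnMA add1n expnS.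
Qed.

Lemma digits_rcons0 n l : (l < 2 ^ n)%N -> digits n.+1 l = rcons (digits n l) false.
Proof.
by move=> ln; rewrite /digits mkseqS divn_small.
Qed.

Lemma digits_top n l : (l < 2 ^ n)%N ->
  digits n.+1 (2 ^ n + l) = rcons (digits n l) true.
Proof.
elim: n l => [|n IH] l ln; first by case: l ln.
rewrite digitsS [digits n.+1 l]digitsS rcons_cons -IH; last by rewrite expnS in ln; lia.
have -> : odd (2 ^ n.+1 + l) = odd l by rewrite expnS oddD oddM.
by have -> : (2 ^ n.+1 + l)./2 = (2 ^ n + l./2)%N by rewrite expnS; lia.
Qed.

Lemma digits_shift p n l : digits (p + n) (2 ^ p * l) = nseq p false ++ digits n l.
Proof.
elim: p => [|p IH]; first by rewrite mul1n.
have -> : (2 ^ p.+1 * l = (2 ^ p * l).*2)%N by rewrite expnS; lia.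
by rewrite addSn digitsS odd_double doubleK IH.
Qed.

Lemma count_digits n l : (l < 2 ^ n)%N -> count id (digits n l) = sigma1 l.
Proof.
have ext q : (l < 2 ^ q)%N -> forall m, (\sum_(i < q + m) odd (l %/ 2 ^ i) =
    \sum_(i < q) odd (l %/ 2 ^ i))%N.
  move=> lq m; rewrite big_split_ord /= [X in (_ + X)%N]big1 ?addn0// => i _.
  by rewrite divn_small// expnD; apply: leq_trans lq _; rewrite leq_pmulr ?expn_gt0.
move=> ln; rewrite /sigma1 -(ext l (ltn_expl l (isT : 1 < 2)%N) n) addnC ext//.
rewrite /digits /mkseq count_map -sum1_count big_mkcond /=.
rewrite -(big_mkord xpredT (fun i => nat_of_bool (odd (l %/ 2 ^ i)))) /index_iota subn0.
by apply: eq_bigr => i _; case: odd.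
Qed.

Lemma digits_two_val n l : (0 < l)%N -> (l < 2 ^ n)%N ->
  exists2 bs, digits n l = nseq (two_val l) false ++ true :: bs &
    n = (two_val l + (size bs).+1)%N.
Proof.
move=> l0 ln; set p := two_val l.
have pl : (2 ^ p %| l)%N by rewrite pfactor_dvdn.
have pn : (p < n)%N.
  by rewrite -(ltn_exp2l _ _ (isT : 1 < 2)%N); apply: leq_ltn_trans ln; exact: dvdn_leq.
have [l' l'2 lE] := pfactor_coprime (isT : prime 2) l0.
rewrite coprime2n in l'2.
exists (digits (n - p).-1 l'./2); last by rewrite size_digits; lia.
rewrite {1}lE mulnC -/(two_val l) -/p -{1}(subnKC (ltnW pn)) digits_shift.
by rewrite -{1}(prednK (_ : 0 < n - p)%N) ?digitsS ?l'2//; lia.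
Qed.

(** * Leja sequences *)

Section Leja.
Variable R : realType.
Implicit Types (z c d : R[i]) (bs : seq bool) (e : nat -> R[i]).

Lemma nodal0 n z c : nodal (digits n 0) z c = 1.
Proof. by elim: n z c => [|n IH] z c //; rewrite digitsS /= mul1r IH. Qed.

Lemma size_nodes n k c : (k < 2 ^ n)%N -> size (nodes (digits n k) c) = k.
Proof.
elim: n k c => [|n IH] k c; first by case: k.
rewrite expnS => kn; rewrite digitsS /= size_cat size_lift IH; last by lia.
by case ok: (odd k) => /=; lia.
Qed.

Lemma size_nodes0 bs c : count id bs = 0%N -> size (nodes bs c) = 0%N.
Proof.
elim: bs c => [|b bs IH] c //=; case: b => //= h.
by rewrite size_lift IH.
Qed.

(** Carry propagation: appending the node [c] multiplies the nodal polynomial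
    by [z - c]; if the last digit is zero this factor is [z + d] with
    [d = - c], and otherwise it merges with [z + c] into [z^2 - c^2], which
    appends the node [c^2] to the nodes in the variable [z^2]. *)
Lemma nodal_succ n k c : normc c = 1 -> (k.+1 < 2 ^ n)%N ->
  exists2 d, normc d = 1 &
    forall z, nodal (digits n k) z c * (z - c) = nodal (digits n k.+1) z d.
Proof.
elim: n k c => [|n IH] k c c1 kn; first by case: k kn.
rewrite !digitsS; have [ok|ok] := boolP (odd k).
  have [||d d1 hd] := IH k./2 (c ^+ 2); first by rewrite normc_exp c1 expr1n.
    by rewrite expnS in kn; lia.
  exists (sqrtc d) => [|z]; first exact: normc_sqrt.
  rewrite /= ok /= sqr_sqrtc mul1r uphalf_half ok -hd.
  by rewrite subr_sqr; ring.
exists (- c) => [|z]; first by rewrite normc_opp.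
by rewrite /= ok uphalf_half (negbTE ok) sqrrN mul1r mulrC.
Qed.

(** By [nodal_succ] the nodal polynomial has the digit form for some [d] on the
    circle, where its modulus is the maximal value [2 ^ sigma]; the Leja point
    is then another maximizer, and [nodal_max] applies. *)
Lemma leja_nodal n (e : nat -> R[i]) k : leja e -> (k < 2 ^ n)%N ->
  normc (e k) = 1 /\ forall z, \prod_(j < k) (z - e j) = nodal (digits n k) z (e k).
Proof.
move=> [e0 eM]; elim: k => [|k IH] kn.
  by rewrite e0 normc1; split=> // z; rewrite big_ord0 nodal0.
have [] := IH (ltnW kn).
move=> ek1 hk; have [d d1 hd] := nodal_succ ek1 kn.
have hS z : \prod_(j < k.+1) (z - e j) = nodal (digits n k.+1) z d.
  by rewrite big_ord_recr /= hk hd.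
have [eD eX] := eM k.+1 isT.
have := eX d; rewrite -!normc_prod !hS /unit_disc /= d1 => /(_ (lexx 1)).
rewrite normc_nodal_diag// => hmax.
have [ext e1] := nodal_max eD d1 hmax.
split=> [|z]; last by rewrite hS ext.
apply: e1; rewrite has_count lt0n; apply: contraTneq isT => h0.
have := size_nodes d kn.
by rewrite size_nodes0.
Qed.

Lemma leja_circle (e : nat -> R[i]) k : leja e -> normc (e k) = 1.
Proof. by move=> eL; have [] := leja_nodal eL (ltn_expl k (isT : 1 < 2)%N). Qed.

Lemma leja_nodes n (e : nat -> R[i]) k : leja e -> (k < 2 ^ n)%N ->
  perm_eq (mkseq e k) (nodes (digits n k) (e k)).
Proof.
move=> eL kn; have [c1 hn] := leja_nodal eL kn.
have uN := nodes_uniq (digits n k) c1.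
have sz : size (nodes (digits n k) (e k)) = size (mkseq e k).
  by rewrite size_nodes// size_mkseq.
have sub : {subset nodes (digits n k) (e k) <= mkseq e k}.
  move=> a aN; have : \prod_(j < k) (a - e j) = 0.
    by rewrite hn -prod_nodes (perm_big _ (perm_to_rem aN)) /= big_cons subrr mul0r.
  move=> /eqP; rewrite prodf_seq_eq0 => /hasP[j _ /=]; rewrite subr_eq0 => /eqP ->.
  by apply: map_f; rewrite mem_iota /=.
rewrite perm_sym; apply: perm_of_sub => //; last by rewrite sz.
by apply: (leq_size_uniq uN sub); rewrite sz.
Qed.

(** The digits of [2 ^ n.+1 + l] are those of [l], a zero, which contributes no
    node, and a leading one. *)
Lemma leja_nodes_top n (e : nat -> R[i]) l : leja e -> (l < 2 ^ n)%N ->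
  perm_eq (mkseq e (2 ^ n.+1 + l))
    (nodes (digits n l) (e (2 ^ n.+1 + l)%N) ++
     roots2 n.+1 (- e (2 ^ n.+1 + l)%N ^+ (2 ^ n.+1))).
Proof.
move=> eL ln; have ln1 : (l < 2 ^ n.+1)%N by rewrite expnS; lia.
have := @leja_nodes n.+2 e (2 ^ n.+1 + l) eL.
rewrite digits_top// nodes_rcons size_digits digits_rcons0// nodes_rcons0; apply.
by rewrite (expnS 2 n.+1); lia.
Qed.

(** The first [2 ^ n.+1] terms are the roots of unity of that order. They are
    too many to lie among the [l] nodes of the lower digits, so one of them
    lies in the coset of the leading digit, which must be the trivial one. *)
Lemma leja_pow n (e : nat -> R[i]) l : leja e -> (l < 2 ^ n)%N ->
  e (2 ^ n.+1 + l)%N ^+ (2 ^ n.+1) = -1.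
Proof.
move=> eL ln; set c := e _.
have := @leja_nodes_top n e 0 eL; rewrite expn_gt0 => /(_ isT).
rewrite addn0; set d := e _.
have -> : nodes (digits n 0) d = [::].
  by apply: size0nil; rewrite size_nodes// expn_gt0.
rewrite cat0s => P0.
have U1 j : (j < 2 ^ n.+1)%N -> e j ^+ (2 ^ n.+1) = 1.
  have U0 i : (i < 2 ^ n.+1)%N -> e i ^+ (2 ^ n.+1) = - d ^+ (2 ^ n.+1).
    move=> iN; apply/eqP; rewrite -mem_roots2 -(perm_mem P0).
    by apply: map_f; rewrite mem_iota.
  move=> jN; rewrite (U0 _ jN) -(U0 0%N) ?expn_gt0//.
  by have [-> _] := eL; rewrite expr1n.
have P1 := leja_nodes_top eL ln; rewrite -/c in P1.
apply/eqP; rewrite -eqr_oppLR; apply: contraT => cN.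
suff : (2 ^ n.+1 <= l)%N by rewrite expnS; lia.
have c1 : normc c = 1 by exact: leja_circle.
have <- : size (nodes (digits n l) c) = l by rewrite size_nodes.
rewrite -(size_mkseq e (2 ^ n.+1)); apply: uniq_leq_size.
  by rewrite (perm_uniq P0) roots2_uniq// oppr_eq0 expf_neq0// circle_neq0// leja_circle.
move=> a /mapP[j]; rewrite mem_iota /= add0n => jN ->.
have : e j \in mkseq e (2 ^ n.+1 + l).
  by apply: map_f; rewrite mem_iota /= add0n; lia.
rewrite (perm_mem P1) mem_cat => /orP[//|]; rewrite mem_roots2 U1// => /eqP h.
by rewrite -h eqxx in cN.
Qed.

End Leja.

(** * Moduli of Lagrange polynomials *)

Section Lag.
Variable R : realType.
Implicit Types (z w s a b c f : R[i]) (A B S : seq R[i]) (bs : seq bool).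

(** The modulus at [z] of the Lagrange polynomial of the node [b]. Filtering out
    [b] by value makes it invariant under permutation of the nodes. *)
Definition lag A b z : R := \prod_(a <- A | a != b) (normc (z - a) / normc (b - a)).

Lemma lag_ge0 A b z : 0 <= lag A b z.
Proof. by apply: prodr_ge0 => a _; rewrite divr_ge0 ?normc_ge0. Qed.

Lemma lag_perm A B b z : perm_eq A B -> lag A b z = lag B b z.
Proof. by move=> AB; rewrite /lag (perm_big _ AB). Qed.

(** For [s <> b^2] the two square roots of [s] contribute the factor of [s] at
    [z^2]; the remaining node is [- b], with [|b - (- b)| = 2]. *)
Lemma lag_lift A b z : uniq A -> b ^+ 2 \in A -> normc b = 1 ->
  lag (lift A) b z = lag A (b ^+ 2) (z ^+ 2) * (normc (z + b) / 2).
Proof.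
move=> uA bA b1; rewrite /lag big_mkcond big_lift (bigD1_seq (b ^+ 2))//= mulrC.
rewrite -big_filter -[in RHS]big_filter; congr (_ * _).
  apply: eq_big_seq => s; rewrite mem_filter => /andP[sb _].
  have n1 : sqrtc s != b by apply: contra sb => /eqP <-; rewrite sqr_sqrtc.
  have n2 : - sqrtc s != b by apply: contra sb => /eqP <-; rewrite sqrrN sqr_sqrtc.
  rewrite n1 n2 mulf_div -!normcM !opprK -!subr_sqr sqr_sqrtc //.
have b0 := circle_neq0 b1.
have nbb : b != - b.
  rewrite -subr_eq0 opprK -mulr2n mulrn_eq0 //.
have b2 := normc_double b1.
case: (@sqrt_cases R (b ^+ 2) b erefl) => e.
  rewrite -e eqxx mul1r eq_sym nbb.
  by rewrite !opprK b2.
have -> : sqrtc (b ^+ 2) = - b by rewrite [in RHS]e opprK.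
by rewrite opprK eqxx mulr1 eq_sym nbb b2.
Qed.

Lemma lag_cons e A b z : e != b ->
  lag (e :: A) b z = normc (z - e) / normc (b - e) * lag A b z.
Proof. by move=> eb; rewrite /lag big_cons eb. Qed.

Lemma lag_head e A z : e \notin A ->
  lag (e :: A) e z = normc (\prod_(a <- A) (z - a)) / normc (\prod_(a <- A) (e - a)).
Proof.
move=> eA; have /all_filterP fA : all (fun a => a != e) A.
  by apply/allP => a aA; apply: contraNneq eA => <-.
by rewrite /lag big_cons eqxx /= -big_filter fA big_split /= prodfV !normc_prod.
Qed.

(** Cosets other than the one of [b] contribute, as in [lag_lift], the
    factors of a Lagrange polynomial in the variable [z ^ 2^p]. *)
Lemma lag_iter_lift p A b z : uniq A -> 0 \notin A -> b ^+ (2 ^ p) \in A ->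
  normc b = 1 ->
  lag (iter p (@lift R) A) b z =
  lag A (b ^+ (2 ^ p)) (z ^+ (2 ^ p)) * lag (roots2 p (b ^+ (2 ^ p))) b z.
Proof.
move=> uA A0; elim: p b z => [|p IH] b z bA b1.
  rewrite expn0 !expr1 (_ : lag (roots2 0 b) b z = 1) ?mulr1//.
  by rewrite /lag big_cons big_nil eqxx.
rewrite expnS !exprM in bA *.
have b2 : normc (b ^+ 2) = 1 by rewrite normc_exp b1 expr1n.
rewrite [iter _ _ _]/= [roots2 _ _]/= !lag_lift ?IH ?mulrA//.
- by rewrite roots2_uniq// expf_neq0// circle_neq0.
- by rewrite mem_roots2.
- exact: iter_lift_uniq.
- by rewrite mem_iter_lift.
Qed.

Lemma normc_lagrange S (j : 'I_(size S)) z : uniq S ->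
  normc (lagrange j z) = lag S S`_j z.
Proof.
move=> uS; rewrite /lagrange normc_prod /lag (big_nth 0) big_mkord.
apply: eq_big => [i|i _]; first by rewrite nth_uniq.
by rewrite normcM normcV.
Qed.

Lemma sum_lagrange S z : uniq S ->
  \sum_(j < size S) normc (lagrange j z) = \sum_(b <- S) lag S b z.
Proof.
move=> uS; rewrite [RHS](big_nth 0) big_mkord.
by apply: eq_bigr => j _; rewrite normc_lagrange.
Qed.

Definition nodal_abs S z := normc (\prod_(a <- S) (z - a)).

Lemma nodal_abs_ge0 S z : 0 <= nodal_abs S z. Proof. exact: normc_ge0. Qed.

Lemma nodal_abs_perm S A z : perm_eq S A -> nodal_abs S z = nodal_abs A z.
Proof. by move=> p; rewrite /nodal_abs (perm_big _ p). Qed.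

Lemma nodal_abs_cons a S z : nodal_abs (a :: S) z = normc (z - a) * nodal_abs S z.
Proof. by rewrite /nodal_abs big_cons normcM. Qed.

Lemma nodal_abs_cat S A z : nodal_abs (S ++ A) z = nodal_abs S z * nodal_abs A z.
Proof. by rewrite /nodal_abs big_cat normcM. Qed.

Lemma nodal_abs_conj S z : nodal_abs [seq conjc a | a <- S] z = nodal_abs S (conjc z).
Proof.
rewrite /nodal_abs big_map !normc_prod; apply: eq_bigr => a _; exact: normc_conj_sub.
Qed.

Lemma nodal_abs_gt0 S z : z \notin S -> 0 < nodal_abs S z.
Proof.
move=> zS; rewrite /nodal_abs normc_gt0; apply/negP => /eqP/eqP; rewrite prodf_seq_eq0.
by move=> /hasP[a aS /=]; rewrite subr_eq0 => /eqP e; rewrite e aS in zS.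
Qed.

Lemma nodal_abs_ratio S z b :
  nodal_abs S z / nodal_abs S b = \prod_(a <- S) (normc (z - a) / normc (b - a)).
Proof. by rewrite /nodal_abs !normc_prod big_split /= prodfV. Qed.

Lemma lag_rem S b z : uniq S -> lag S b z = nodal_abs (rem b S) z / nodal_abs (rem b S) b.
Proof. by move=> uS; rewrite nodal_abs_ratio rem_filter// big_filter. Qed.

End Lag.

(** * The quadratic Lebesgue function *)

Section Quadratic.
Variable R : realType.
Implicit Types (z c f : R[i]) (bs : seq bool).

(** The parallelogram identity turns the sum of squares into
    [2 (|z c - f^2|^2 + |c - z|^2)]. Both [(z + c) (z c - f^2)] and
    [(z + c) (c - z)] are combinations of [c^2 - f^2] and [z^2 - f^2] with
    coefficients of modulus 1. *)
Lemma bit_amplitude z c f : normc z = 1 -> normc c = 1 -> normc f = 1 ->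
  normc (z + c) ^+ 2 * (normc ((z + f) * (c - f)) ^+ 2 + normc ((z - f) * (c + f)) ^+ 2)
  <= 4 * (normc (c ^+ 2 - f ^+ 2) + normc (z ^+ 2 - f ^+ 2)) ^+ 2.
Proof.
move=> z1 c1 f1; set P := normc (c ^+ 2 - _); set Q := normc (z ^+ 2 - _).
have -> : (z + f) * (c - f) = (z * c - f ^+ 2) + f * (c - z) by ring.
have -> : (z - f) * (c + f) = (z * c - f ^+ 2) - f * (c - z) by ring.
rewrite normc_parallelogram [normc (f * _)]normcM f1 mul1r.
have h1 : normc (z + c) * normc (z * c - f ^+ 2) <= P + Q.
  rewrite -normcM (_ : (z + c) * (z * c - f ^+ 2) =
    z * (c ^+ 2 - f ^+ 2) + c * (z ^+ 2 - f ^+ 2)); last ring.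
  by apply: le_trans (ler_normcD _ _) _; rewrite !normcM z1 c1 !mul1r.
have h2 : normc (z + c) * normc (c - z) <= P + Q.
  rewrite -normcM (_ : (z + c) * (c - z) = (c ^+ 2 - f ^+ 2) - (z ^+ 2 - f ^+ 2)); last ring.
  exact: ler_normcB.
have sq (x : R) : 0 <= x -> x <= P + Q -> x ^+ 2 <= (P + Q) ^+ 2.
  by move=> x0 xPQ; rewrite lerXn2r ?nnegrE ?addr_ge0 ?normc_ge0.
have := sq _ _ h1; rewrite exprMn mulr_ge0 ?normc_ge0// => /(_ isT) h3.
have := sq _ _ h2; rewrite exprMn mulr_ge0 ?normc_ge0// => /(_ isT) h4.
by rewrite mulrCA mulrDr; lra.
Qed.

(** Effect of a digit one on the weights of [quadratic_lebesgue], at the pair of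
    opposite nodes [f] and [- f]. With [P = |c^2 - f^2|] and
    [Q = |z^2 - f^2|], the bound [(P + Q)^2 <= 3/2 P^2 + 3 Q^2] keeps the
    coefficient of [P^2] below 2. *)
Lemma bit_weight z c f (al be : R) :
  normc z = 1 -> normc c = 1 -> normc f = 1 -> c ^+ 2 != f ^+ 2 ->
  0 <= al -> 0 <= be ->
  (normc (z + f) / 2 * (normc (z + c) / normc (f + c))) ^+ 2 *
     (al + be * (normc (z - f) / normc (c - f)) ^+ 2) +
  (normc (z - f) / 2 * (normc (z + c) / normc (- f + c))) ^+ 2 *
     (al + be * (normc (z + f) / normc (c + f)) ^+ 2)
  <= 3 / 2 * al +
     (2 * be + 3 * al) * (normc (z ^+ 2 - f ^+ 2) / normc (c ^+ 2 - f ^+ 2)) ^+ 2.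
Proof.
move=> z1 c1 f1 cf al0 be0; have := bit_amplitude z1 c1 f1.
have P0 : 0 < normc (c ^+ 2 - f ^+ 2) by rewrite normc_gt0 subr_eq0.
have w4 : normc (z + c) ^+ 2 <= 4.
  by rewrite -(normc_addsub2 z1 c1) lerDl sqr_ge0.
rewrite !normcM (_ : - f + c = c - f); last by rewrite addrC.
rewrite (addrC f c) !subr_sqr !normcM.
move: P0; rewrite !subr_sqr normcM.
set p := normc (z + f); set q := normc (z - f); set u := normc (c + f);
set v := normc (c - f); set w := normc (z + c) in w4 *.
move=> P0; have v0 : v != 0 by apply: contraTneq P0 => ->; rewrite mul0r ltxx.
have u0 : u != 0 by apply: contraTneq P0 => ->; rewrite mulr0 ltxx.
move=> h.
rewrite -subr_ge0 (_ : _ - _ =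
   (al * ((6 * (v * u) ^+ 2 + 12 * (q * p) ^+ 2) -
      w ^+ 2 * ((p * v) ^+ 2 + (q * u) ^+ 2)) +
      be * (2 * (4 - w ^+ 2)) * (q * p) ^+ 2) / (2 * (v * u)) ^+ 2); last first.
  by field; rewrite u0 v0.
apply: divr_ge0; last exact: sqr_ge0.
apply: addr_ge0; last first.
  by apply: mulr_ge0; [apply: mulr_ge0 => //; lra|exact: sqr_ge0].
apply: mulr_ge0 => //; rewrite subr_ge0; apply: le_trans h _.
(* [(P + Q)^2 <= 3/2 P^2 + 3 Q^2] amounts to [0 <= (P - 2 Q)^2]. *)
by have := sqr_ge0 (v * u - 2 * (q * p)); nra.
Qed.

(** Counterpart of [bit_weight] for a digit zero: two applications of the
    parallelogram identity give the weights back exactly. *)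
Lemma nobit_weight z c f (al be : R) :
  normc z = 1 -> normc c = 1 -> normc f = 1 -> c ^+ 2 != f ^+ 2 ->
  (normc (z + f) / 2) ^+ 2 * (al + be * (normc (z - f) / normc (c - f)) ^+ 2) +
  (normc (z - f) / 2) ^+ 2 * (al + be * (normc (z + f) / normc (c + f)) ^+ 2)
  = al + be * (normc (z ^+ 2 - f ^+ 2) / normc (c ^+ 2 - f ^+ 2)) ^+ 2.
Proof.
move=> z1 c1 f1 cf.
have P0 : normc (c ^+ 2 - f ^+ 2) != 0 by rewrite normc_eq0 subr_eq0.
have := normc_addsub2 z1 f1; have := normc_addsub2 c1 f1.
move: P0; rewrite !subr_sqr !normcM mulf_eq0 negb_or => /andP[].
set p := normc (z + f); set q := normc (z - f); set u := normc (c + f);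
set v := normc (c - f) => v0 u0 uv pq.
rewrite -[RHS](_ : al * (p ^+ 2 + q ^+ 2) / 4 +
  be * ((q * p) / (v * u)) ^+ 2 * (u ^+ 2 + v ^+ 2) / 4 = _).
  by field; rewrite u0 v0.
by rewrite pq uv; field; rewrite u0 v0.
Qed.

(** The sum of squared Lagrange moduli is the case [al = 1], [be = 0]. The second
    kind of weight is forced by the digits one: the extra node [- c] multiplies
    the Lagrange polynomial of [a] by [|z + c| / |a + c|]. *)
Lemma quadratic_lebesgue bs z c (al be : R) :
  normc z = 1 -> normc c = 1 -> 0 <= al -> 0 <= be ->
  \sum_(s <- nodes bs c) lag (nodes bs c) s z ^+ 2 *
     (al + be * (normc (z - s) / normc (c - s)) ^+ 2)
  <= 6 * 2 ^+ count id bs * al + (2 ^+ count id bs - 1) * be.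
Proof.
elim: bs z c al be => [|b bs IH] z c al be z1 c1 al0 be0.
  by rewrite big_nil /=; lra.
have z2 : normc (z ^+ 2) = 1 by rewrite normc_exp z1 expr1n.
have c2 : normc (c ^+ 2) = 1 by rewrite normc_exp c1 expr1n.
rewrite /=; set A := nodes bs (c ^+ 2).
have uA : uniq A by exact: nodes_uniq.
have cA s : s \in A -> c ^+ 2 != s.
  by apply: contraTneq => <-; exact: nodes_notin.
have s1 s : s \in A -> normc (sqrtc s) = 1.
  by move=> /(nodes_circle c2); exact: normc_sqrt.
have lagE s a : s \in A -> a ^+ 2 = s -> normc a = 1 ->
    lag (lift A) a z = lag A s (z ^+ 2) * (normc (z + a) / 2).
  by move=> sA as2 a1; rewrite -as2 in sA *; exact: lag_lift.
case: b => /=; last first.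
  rewrite big_lift add0n; apply: le_trans (IH _ _ al be z2 c2 al0 be0).
  rewrite le_eqVlt; apply/predU1P; left.
  apply: eq_big_seq => s sA /=.
  rewrite (lagE s (sqrtc s))// ?sqr_sqrtc ?s1//.
  rewrite (lagE s (- sqrtc s))// ?sqrrN ?sqr_sqrtc ?normc_opp ?s1//.
  rewrite !opprK.
  have := @nobit_weight z c (sqrtc s) al be z1 c1 (s1 _ sA).
  by rewrite sqr_sqrtc => /(_ (cA _ sA)) <-; ring.
rewrite big_cons.
have mcA : - c \notin lift A by rewrite mem_lift sqrrN; apply/negP => /cA; rewrite eqxx.
have p : (1 : R) <= 2 ^+ count id bs by rewrite exprn_ege1// ler1n.
have h1 : lag (- c :: lift A) (- c) z ^+ 2 <= 1.
  rewrite lag_head// expr_le1 ?divr_ge0 ?normc_ge0// !prod_lift_sub sqrrN !prod_nodes.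
  rewrite ler_pdivrMr ?normc_nodal_diag ?exprn_gt0// mul1r.
  by apply: normc_nodal_le; rewrite ?z2.
have h2 : be * (normc (z - - c) / normc (c - - c)) ^+ 2 <= be.
  rewrite ler_piMr// expr_le1 ?divr_ge0 ?normc_ge0// !opprK.
  rewrite normc_double// ler_pdivrMr// mul1r.
  by apply: le_trans (ler_normcD _ _) _; rewrite z1 c1.
have h3 : lag (- c :: lift A) (- c) z ^+ 2 *
    (al + be * (normc (z - - c) / normc (c - - c)) ^+ 2) <= al + be.
  apply: le_trans (_ : 1 * (al + be) <= _); last by rewrite mul1r.
  apply: ler_pM => //; first exact: sqr_ge0.
    by apply: addr_ge0 => //; apply: mulr_ge0 => //; exact: sqr_ge0.
  by rewrite lerD2l.
have h4 := IH (z ^+ 2) (c ^+ 2) (3 / 2 * al) (2 * be + 3 * al) z2 c2.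
have {h4} h4 := h4 ltac:(lra) ltac:(lra).
apply: le_trans (lerD h3 (le_trans _ h4)) _; last first.
  by rewrite exprS; nra.
rewrite big_lift big_seq [leRHS]big_seq; apply: ler_sum => s sA /=.
have nc a : a ^+ 2 = s -> - c != a.
  by move=> as2; apply: contraNneq (cA _ sA) => e; rewrite -as2 -e sqrrN.
rewrite !lag_cons ?nc ?sqrrN ?sqr_sqrtc//.
rewrite (lagE s (sqrtc s))// ?sqr_sqrtc ?s1//.
rewrite (lagE s (- sqrtc s))// ?sqrrN ?sqr_sqrtc ?normc_opp ?s1//.
rewrite !opprK.
have := @bit_weight z c (sqrtc s) al be z1 c1 (s1 _ sA).
rewrite sqr_sqrtc => /(_ (cA _ sA) al0 be0) h5.
have := ler_wpM2l (sqr_ge0 (lag A s (z ^+ 2))) h5.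
apply: le_trans; rewrite le_eqVlt; apply/predU1P; left; ring.
Qed.

End Quadratic.

(** * Inverse squares of nodal polynomials *)

Section InverseSquares.
Variable R : realType.
Implicit Types (s t c f : R[i]) (bs : seq bool).

(** Over the common denominator the numerators add up to 4, by the
    parallelogram identity. *)
Lemma inv_pair f c : normc f = 1 -> normc c = 1 -> f ^+ 2 != c ^+ 2 ->
  (normc (f - c) ^+ 2)^-1 + (normc (- f - c) ^+ 2)^-1 =
  4 / normc (f ^+ 2 - c ^+ 2) ^+ 2.
Proof.
move=> f1 c1 fc.
have P0 : normc (f ^+ 2 - c ^+ 2) != 0 by rewrite normc_eq0 subr_eq0.
rewrite -opprD normc_opp -(normc_addsub2 f1 c1).
move: P0; rewrite !subr_sqr !normcM mulf_eq0 negb_or => /andP[v0 u0].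
by field; rewrite u0 v0.
Qed.

(** The extra factor [|v - c|^2] is what makes the recursion close: with a digit
    one, [|v + c| |v - c| = |v^2 - c^2|] is the same for both square roots; with
    a digit zero, [inv_pair] restores the factor. *)
Lemma sum_inv_nodal_dist bs c t : normc c = 1 -> normc t = 1 ->
  t != c ^+ (2 ^ size bs) ->
  (\sum_(v <- roots2 (size bs) t) (normc (nodal bs v c) ^+ 2 * normc (v - c) ^+ 2)^-1)
  * 2 ^+ count id bs
  = 4 ^+ size bs / normc (t - c ^+ (2 ^ size bs)) ^+ 2.
Proof.
elim: bs c => [|b bs IH] c c1 t1 tc.
  by rewrite /= big_seq1 normc1 !expn0 !expr1 !expr0 expr1n !mul1r mulr1.
have c2 : normc (c ^+ 2) = 1 by rewrite normc_exp c1 expr1n.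
have tc' : t != (c ^+ 2) ^+ (2 ^ size bs) by rewrite -exprM -expnS.
rewrite [4 ^+ _]exprS expnS exprM -[RHS]mulrA -(IH _ c2 t1 tc') [roots2 _ _]/=.
rewrite big_lift mulrA mulr_sumr /= exprD mulrA; congr (_ * _).
rewrite mulr_suml; apply: eq_big_seq => s ts.
have /eqP st : s ^+ (2 ^ size bs) == t by rewrite -mem_roots2.
have s1 : normc (sqrtc s) = 1 by apply/normc_sqrt/(roots2_circle t1 ts).
have sc : sqrtc s ^+ 2 != c ^+ 2.
  by apply: contraNneq tc' => <-; rewrite sqr_sqrtc st.
have := inv_pair s1 c1 sc; rewrite sqr_sqrtc => e.
rewrite sqrrN sqr_sqrtc; set V := nodal bs s (c ^+ 2).
set f := sqrtc s in s1 sc e *.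
have D1 : normc (f + c) * normc (f - c) = normc (s - c ^+ 2).
  by rewrite -normcM mulrC -subr_sqr sqr_sqrtc.
have D2 : normc (- f + c) * normc (- f - c) = normc (s - c ^+ 2).
  by rewrite -normcM mulrC -subr_sqr sqrrN sqr_sqrtc.
case: b {tc} => /=.
  rewrite expr1 !normcM -!exprMn ![_ * normc V * _]mulrAC D1 D2.
  by rewrite [normc V * _]mulrC; set X := (_ ^+ 2)^-1; ring.
by rewrite expr0 mulr1 !mul1r ![(normc V ^+ 2 * _)^-1]invfM -mulrDr e; set X := (_ ^+ 2)^-1;
  set Y := (_ ^+ 2)^-1; ring.
Qed.

(** The lowest digit being one, [inv_pair] produces the factor [|v - c|^2] of
    [sum_inv_nodal_dist] at the next level. *)
Lemma sum_inv_nodal bs c : normc c = 1 ->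
  (\sum_(v <- roots2 (size bs).+1 (- c ^+ (2 ^ (size bs).+1)))
     (normc (nodal (true :: bs) v c) ^+ 2)^-1) * 2 ^+ count id bs = 4 ^+ size bs.
Proof.
move=> c1; rewrite expnS exprM.
have c2 : normc (c ^+ 2) = 1 by rewrite normc_exp c1 expr1n.
set t := - _; have t1 : normc t = 1 by rewrite normc_opp normc_exp c2 expr1n.
have tt : normc (t - (c ^+ 2) ^+ (2 ^ size bs)) = 2.
  by rewrite -opprD normc_opp normc_double// normc_exp c2 expr1n.
have tc : t != (c ^+ 2) ^+ (2 ^ size bs) by rewrite -subr_eq0 -normc_eq0 tt pnatr_eq0.
have := sum_inv_nodal_dist c2 t1 tc; rewrite tt => e.
rewrite (_ : 4 ^+ size bs = 4 * (4 ^+ size bs / 2 ^+ 2) :> R); last by field.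
rewrite -e mulrA mulr_sumr [roots2 _ _]/= big_lift; congr (_ * _).
apply: eq_big_seq => s ts /=; rewrite sqrrN sqr_sqrtc.
have /eqP st : s ^+ (2 ^ size bs) == t by rewrite -mem_roots2.
have s1 : normc (sqrtc s) = 1 by apply/normc_sqrt/(roots2_circle t1 ts).
have sc : sqrtc s ^+ 2 != c ^+ 2.
  by apply: contraNneq tc => <-; rewrite sqr_sqrtc st.
have := inv_pair s1 c1 sc; rewrite sqr_sqrtc => h.
rewrite !normcM !exprMn; set V := normc (nodal _ _ _) ^+ 2.
rewrite -(normc_opp (- sqrtc s + c)) opprD opprK -(normc_opp (sqrtc s + c)) opprD.
rewrite addrC ![(_ * V)^-1]invfM -mulrDl h -mulrA; congr (_ * _).
by rewrite [RHS]invfM mulrC.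
Qed.

(** Conjugation permutes the roots of unity and, since [c ^ 2^(n+1)] is a square
    root of -1 for [n = size bs], maps the other nodes into the coset on which
    [sum_inv_nodal] applies. *)
Lemma sum_inv_nodal_conj bs c : normc c = 1 -> c ^+ (2 ^ (size bs).+2) = -1 ->
  (\sum_(v <- nodes (rcons (rcons (true :: bs) false) true) c)
     (normc (nodal (true :: bs) (conjc v) c) ^+ 2)^-1) * 2 ^+ count id bs
  <= 5 * 4 ^+ size bs.
Proof.
move=> c1 cN.
have F0 v : 0 <= (normc (nodal (true :: bs) v c) ^+ 2)^-1 by rewrite invr_ge0 sqr_ge0.
rewrite nodes_rcons nodes_rcons0 size_rcons [size (_ :: _)]/= cN opprK.
rewrite big_cat mulrDl (_ : 5 = 1 + 4 :> R); last by ring.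
rewrite [leRHS]mulrDl mul1r; apply: lerD.
  rewrite -(sum_inv_nodal bs c1) ler_wpM2r ?exprn_ge0//.
  rewrite -(big_map (@conjc R) xpredT (fun v => (normc (nodal (true :: bs) v c) ^+ 2)^-1)).
  apply: ler_sum_sub => //.
  - by rewrite map_inj_uniq ?nodes_uniq//; exact: (can_inj (@conjcK R)).
  - by rewrite roots2_uniq// oppr_eq0 expf_neq0// circle_neq0.
  move=> _ /mapP[a ha ->]; rewrite mem_roots2 -rmorphXn /=.
  rewrite (nodes_pow c1 ha) conjc_circle; last by rewrite normc_exp c1 expr1n.
  set d := c ^+ _; have d0 : d != 0 by rewrite expf_neq0// circle_neq0.
  have d2 : d * d = -1 by rewrite -expr2 -exprM mulnC -expnS.
  by apply/eqP; apply: (mulfI d0); rewrite mulfV// mulrN d2 opprK.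
rewrite -(big_map (@conjc R) xpredT (fun v => (normc (nodal (true :: bs) v c) ^+ 2)^-1)).
have := @perm_conj_roots2 R (size bs).+2 1 (oner_neq0 _); rewrite rmorph1 => PJ.
rewrite (perm_big _ PJ) /=.
have := sum_inv_nodal (rcons bs false) c1.
have E v : nodal (true :: rcons bs false) v c = nodal (true :: bs) v c.
  by rewrite -rcons_cons nodal_rcons mulr1.
rewrite size_rcons cN opprK count_rcons addn0 exprS => <-.
by rewrite le_eqVlt; apply/predU1P; left; congr (_ * _); apply: eq_bigr => v _; rewrite E.
Qed.

End InverseSquares.

(** * Cosets of roots of unity *)

Section Cosets.
Variable R : realType.
Implicit Types (z w s b u : R[i]) (A S : seq R[i]).

(** The supremum defining the Lebesgue constant dominates the values because
    the function is bounded: each factor is at most [2 / |b - a|]. *)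
Lemma lebesgue_function_le S z : uniq S -> {in S, forall a, normc a = 1} ->
  normc z <= 1 ->
  \sum_(b <- S) lag S b z <= lebesgue_constant (@unit_disc R) S.
Proof.
move=> uS S1 z1; rewrite -sum_lagrange//; apply: ub_le_sup; last by exists z.
exists (\sum_(b <- S) \prod_(a <- S | a != b) (2 / normc (b - a))).
move=> _ [w w1 <-]; rewrite sum_lagrange//; apply: ler_sum => b _.
rewrite /lag big_seq_cond [leRHS]big_seq_cond; apply: ler_prod => a /andP[aS _].
rewrite divr_ge0 ?normc_ge0//= ler_wpM2r ?invr_ge0 ?normc_ge0//.
by apply: le_trans (ler_normcB _ _) _; rewrite (S1 _ aS) -[leRHS]/(1 + 1) lerD2r.
Qed.

Lemma cis_exp (t : R) k :
  (cos t +i* sin t) ^+ k = cos (t * k%:R) +i* sin (t * k%:R) :> R[i].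
Proof.
elim: k => [|k IH]; first by rewrite expr0 mulr0 cos0 sin0.
rewrite exprS IH -addn1 natrD mulrDr mulr1 cosD sinD.
by apply/eqP; rewrite eq_complex /=; apply/andP; split; apply/eqP; ring.
Qed.

Lemma unity_roots_exp N u : (0 < N)%N -> u \in unity_roots R N -> u ^+ N = 1.
Proof.
move=> N0 /mapP[j _ ->]; rewrite cis_exp.
rewrite (_ : _ * N%:R = 0 + (pi *+ 2) *+ j); last first.
  by rewrite -mulr_natl -[pi *+ 2]mulr_natl; field; rewrite pnatr_eq0 -lt0n.
by rewrite !(periodicn (@cosD2pi R)) !(periodicn (@sinD2pi R)) cos0 sin0.
Qed.

Lemma cos_lt1 (t : R) : 0 < t < 2 * pi -> cos t != 1.
Proof.
move=> t0; rewrite (_ : t = (t / 2) *+ 2); last by rewrite -mulr_natl; field.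
apply/eqP => h; have : 0 < sin (t / 2) by apply: sin_gt0_pi; lra.
have := cos2Dsin2 (t / 2); rewrite cos_mulr2n in h.
by move=> h1 h2; nra.
Qed.

Lemma unity_roots_uniq N : uniq (unity_roots R N).
Proof.
apply/mkseq_uniqP => i j; rewrite !inE.
wlog ij : i j / (i < j)%N.
  move=> H iN jN e; case: (ltngtP i j) => // h; first exact: H.
  by apply/esym/H.
move=> iN jN /= [ec es]; exfalso; move: (cos2Dsin2 (2 * pi * i%:R / N%:R : R)).
rewrite !expr2 {1}ec {1}es -cosB => /eqP.
have N0 : 0 < N%:R :> R by rewrite ltr0n; lia.
rewrite -mulrBl -mulrBr -natrB 1?ltnW//; apply/negP/cos_lt1.
have p2 : 0 < 2 * pi :> R by rewrite mulr_gt0// pi_gt0.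
apply/andP; split.
  by apply: divr_gt0 => //; apply: mulr_gt0 => //; rewrite ltr0n subn_gt0.
by rewrite ltr_pdivrMr// ltr_pM2l// ltr_nat; lia.
Qed.

Lemma roots2_cosets p s b0 : normc b0 = 1 -> b0 ^+ (2 ^ p) = s ->
  perm_eq [seq b0 * u | u <- unity_roots R (2 ^ p)] (roots2 p s).
Proof.
move=> b01 b0s; have b00 := circle_neq0 b01.
apply: perm_of_sub.
- by rewrite map_inj_uniq ?unity_roots_uniq//; exact: mulfI.
- by apply: roots2_uniq; rewrite -b0s expf_neq0.
- move=> _ /mapP[u uN ->]; rewrite mem_roots2 exprMn b0s.
  by rewrite unity_roots_exp ?expn_gt0// mulr1.
- by rewrite size_roots2 size_map size_mkseq.
Qed.

(** A coset is a rotation of the roots of unity, and Lagrange polynomials are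
    equivariant under rotations. *)
Lemma coset_lebesgue p s z : normc s = 1 -> normc z <= 1 ->
  \sum_(b <- roots2 p s) lag (roots2 p s) b z <= lebesgue_unity R (2 ^ p).
Proof.
move=> s1 z1; have [b0 b0in] : exists b0, b0 \in roots2 p s.
  have : has predT (roots2 p s) by rewrite has_predT size_roots2 expn_gt0.
  by move=> /hasP[b0]; exists b0.
have b01 := roots2_circle s1 b0in; have b00 := circle_neq0 b01.
rewrite mem_roots2 in b0in; have P := roots2_cosets b01 (eqP b0in).
rewrite -(perm_big _ P) /= big_map.
under eq_bigr => u _.
  rewrite -(lag_perm _ _ P) /lag big_map.
  under eq_bigl => a do rewrite (inj_eq (mulfI b00)).
  under eq_bigr => a _.
    rewrite (_ : z - b0 * a = b0 * (z / b0 - a)); last by field.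
    rewrite -mulrBr !normcM b01 !mul1r; over.
  over.
apply: lebesgue_function_le; first exact: unity_roots_uniq.
  move=> u /unity_roots_exp; rewrite expn_gt0 => /(_ isT) /(congr1 (@normc R)).
  rewrite normc_exp normc1 => /eqP; rewrite pexprn_eq1 ?normc_ge0//.
  by rewrite expn_eq0 => /eqP.
by rewrite normcM normcV b01 invr1 mulr1.
Qed.

Lemma lebesgue_unity_ge0 p : 0 <= lebesgue_unity R (2 ^ p).
Proof.
apply: le_trans (coset_lebesgue p (normc1 R) (_ : normc 1 <= 1)).
  by apply: sumr_ge0 => b _; exact: lag_ge0.
by rewrite normc1.
Qed.

Lemma sum_lag_iter_lift p A z (g : R[i] -> R) : uniq A ->
  {in A, forall s, normc s = 1} -> normc z <= 1 -> (forall s, 0 <= g s) ->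
  \sum_(b <- iter p (@lift R) A) lag (iter p (@lift R) A) b z * g (b ^+ (2 ^ p))
  <= lebesgue_unity R (2 ^ p) * \sum_(s <- A) lag A s (z ^+ (2 ^ p)) * g s.
Proof.
move=> uA A1 z1 g0; rewrite sum_iter_lift mulr_sumr big_seq [leRHS]big_seq.
apply: ler_sum => s sA; have s1 := A1 _ sA.
have A0 : 0 \notin A by apply/negP => /A1/circle_neq0; rewrite eqxx.
rewrite (eq_big_seq (fun b => lag A s (z ^+ (2 ^ p)) * g s * lag (roots2 p s) b z)).
  rewrite -mulr_sumr mulrC ler_wpM2r ?coset_lebesgue//.
  by rewrite mulr_ge0 ?g0 ?lag_ge0.
move=> b bs; have b1 := roots2_circle s1 bs.
move: bs; rewrite mem_roots2 => /eqP bs.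
by rewrite lag_iter_lift// bs// mulrAC.
Qed.

End Cosets.

(** * Weighted Lebesgue sums *)

Section Weights.
Variable R : realType.
Implicit Types (z w s c : R[i]) (bs : seq bool).

(** The inequality [x y <= (t x^2 + y^2 / t) / 2] with [t = 2 ^ size bs], which
    balances the bounds of [quadratic_lebesgue] and [sum_inv_nodal_conj]. *)
Lemma odd_weighted_sum bs c z w : normc c = 1 -> c ^+ (2 ^ (size bs).+2) = -1 ->
  normc z = 1 -> normc w = 1 ->
  \sum_(s <- nodes (rcons (rcons (true :: bs) false) true) c)
     lag (nodes (rcons (rcons (true :: bs) false) true) c) s z *
     (normc (nodal (true :: bs) w c) / normc (nodal (true :: bs) (conjc s) c))
  <= 22 * 2 ^+ (size bs + count id bs).
Proof.
move=> c1 cN z1 w1; set A := nodes _ c; set W := fun v => normc (nodal (true :: bs) v c).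
rewrite -/(W w); under eq_bigr do rewrite -/(W _).
set t : R := 2 ^+ size bs; set q : R := 2 ^+ count id bs.
have t0 : 0 < t by rewrite exprn_gt0.
have q0 : 0 < q by rewrite exprn_gt0.
have h1 : \sum_(s <- A) lag A s z ^+ 2 <= 24 * q.
  have := quadratic_lebesgue (rcons (rcons (true :: bs) false) true) z1 c1 ler01 (lexx 0).
  rewrite !count_rcons /= addn0 add1n addn1 !(exprS (2 : R)) -/q.
  under eq_bigr do rewrite mul0r addr0 mulr1.
  by rewrite -/A => h; apply: le_trans h _; lra.
have := sum_inv_nodal_conj c1 cN; rewrite -/A -/q (_ : 4 ^+ size bs = t ^+ 2); last first.
  by rewrite /t -exprM mulnC exprM; congr (_ ^+ _); ring.
set X := \sum_(_ <- _) _ => h2.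
have h3 : W w <= 2 * q.
  by rewrite /q -exprS; apply: (normc_nodal_le (true :: bs)) => //; rewrite w1.
have h4 : W w ^+ 2 * X <= 20 * q * t ^+ 2.
  have X0 : 0 <= X by apply: sumr_ge0 => v _; rewrite invr_ge0 sqr_ge0.
  have hW : W w ^+ 2 <= (2 * q) ^+ 2.
    by rewrite lerXn2r ?nnegrE ?normc_ge0 ?mulr_ge0// ltW.
  apply: le_trans (ler_wpM2r X0 hW) _.
  rewrite (_ : _ * X = 4 * q * (X * q)); last ring.
  rewrite (_ : 20 * q * t ^+ 2 = 4 * q * (5 * t ^+ 2)); last ring.
  by rewrite ler_wpM2l// mulr_ge0// ltW.
rewrite exprD -/t -/q.
apply: le_trans (_ : \sum_(s <- A) (t / 2 * lag A s z ^+ 2 +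
   (2 * t)^-1 * (W w ^+ 2 * (W (conjc s) ^+ 2)^-1)) <= _).
  apply: ler_sum => s _; rewrite -subr_ge0.
  rewrite -exprVn -exprMn; set x := lag _ _ _; set y := W w / _.
  rewrite (_ : _ - _ = (t * x - y) ^+ 2 / (2 * t)); last by field; rewrite gt_eqF.
  by rewrite divr_ge0 ?sqr_ge0// mulr_ge0// ltW.
rewrite big_split /= -!mulr_sumr -/X.
apply: le_trans (lerD (ler_wpM2l _ h1) (ler_wpM2l _ h4)) _.
- by rewrite divr_ge0// ltW.
- by rewrite invr_ge0 mulr_ge0// ltW.
by rewrite le_eqVlt; apply/predU1P; left; field; rewrite gt_eqF.
Qed.

(** The weights only depend on the [2 ^ p]-th powers of the nodes, so
    [sum_lag_iter_lift] reduces the claim to [odd_weighted_sum]. *)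
Lemma weighted_sum p bs c z w : let D := nseq p false ++ true :: bs in
  normc c = 1 -> c ^+ (2 ^ (size D).+1) = -1 -> normc z = 1 -> normc w = 1 ->
  \sum_(s <- nodes (rcons (rcons D false) true) c)
     lag (nodes (rcons (rcons D false) true) c) s z *
     (normc (nodal D w c) / normc (nodal D (conjc s) c))
  <= lebesgue_unity R (2 ^ p) * (22 * 2 ^+ (size bs + count id bs)).
Proof.
move=> D c1 cN z1 w1; set A := nodes _ c; set c' := c ^+ (2 ^ p).
have c'1 : normc c' = 1 by rewrite normc_exp c1 expr1n.
have c'N : c' ^+ (2 ^ (size bs).+2) = -1.
  by rewrite -exprM -expnD -cN size_cat size_nseq /= !addnS.
have -> : A = iter p (@lift R) (nodes (rcons (rcons (true :: bs) false) true) c').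
  by rewrite /A !rcons_cat nodes_shift.
set B := nodes _ c'.
set g := fun s => normc (nodal (true :: bs) (w ^+ (2 ^ p)) c') /
                  normc (nodal (true :: bs) (conjc s) c').
have := odd_weighted_sum c'1 c'N (z := z ^+ (2 ^ p)) (w := w ^+ (2 ^ p)).
rewrite !normc_exp z1 w1 expr1n => /(_ erefl erefl) h.
apply: le_trans (ler_wpM2l (lebesgue_unity_ge0 R p) h).
have uB : uniq B by exact: nodes_uniq.
have B1 : {in B, forall s, normc s = 1} by exact: nodes_circle.
have g0 s : 0 <= g s by rewrite divr_ge0 ?normc_ge0.
have := sum_lag_iter_lift p uB B1 (z := z) _ g0; rewrite z1 => /(_ (lexx 1)).
apply: le_trans; rewrite le_eqVlt; apply/predU1P; left.
by apply: eq_bigr => s _; rewrite /g !nodal_shift -rmorphXn.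
Qed.

End Weights.

(** * Projection of symmetric node sets on the real axis *)

Section Projection.
Variable R : realType.
Implicit Types z w a b h : R[i].
Variables C U : seq R[i].
Hypothesis uC : uniq C.
Hypothesis uU : uniq U.
Hypothesis C1 : {in C, forall a, normc a = 1}.
Hypothesis U1 : {in U, forall a, normc a = 1}.
Hypothesis CU : {in C, forall a, a \notin U}.
Hypothesis CJ : {in C, forall a, conjc a \notin C}.
Hypothesis UJ : {in U, forall a, conjc a \in U}.
Hypothesis one_U : 1 \in U.
Hypothesis mone_U : -1 \in U.

Let E := C ++ U.
Let P := [seq a <- U | 0 < complex.Im a].

(** One node of [C ++ U] above each real part: conjugate points of [U] share
    their real part, whereas conjugates of points of [C] are not nodes. *)
Definition half_nodes := 1 :: -1 :: P ++ C.
Let H := half_nodes.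

Lemma union_circle : {in E, forall a, normc a = 1}.
Proof. by move=> a; rewrite mem_cat => /orP[/C1|/U1]. Qed.

Lemma union_uniq : uniq E.
Proof.
rewrite cat_uniq uC uU andbT /=; apply/hasPn => a aU /=.
by apply: contraTN aU => /CU.
Qed.

Lemma perm_half_split : perm_eq U (1 :: -1 :: P ++ [seq conjc a | a <- P]).
Proof.
have PI a : a \in P -> 0 < complex.Im a by rewrite mem_filter => /andP[].
have JI a : a \in [seq conjc a | a <- P] -> complex.Im a < 0.
  by move=> /mapP[b /PI b0 ->]; rewrite Im_conjc oppr_lt0.
apply: uniq_perm => //.
  rewrite !cons_uniq inE negb_or one_neqN1 !mem_cat !negb_or.
  have n (a : R[i]) : complex.Im a = 0 -> (a \notin P) && (a \notin [seq conjc a | a <- P]).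
    by move=> a0; apply/andP; split; apply/negP; [move/PI|move/JI]; rewrite a0 ltxx.
  rewrite !n ?Im_N1 ?Im_1//= cat_uniq filter_uniq// map_inj_uniq ?filter_uniq//; last first.
    exact: conjcI.
  rewrite andbT; apply/hasPn => a /JI a0; apply/negP => /PI.
  by move=> /(lt_trans a0); rewrite ltxx.
move=> a; rewrite !inE mem_cat; apply/idP/idP => [aU|].
  have [a0|a0|a0] := ltgtP (complex.Im a) 0.
  - suff -> : a \in [seq conjc a | a <- P] by rewrite !orbT.
    rewrite -[a]conjcK map_f// mem_filter UJ// Im_conjc oppr_gt0 a0 //.
  - by rewrite mem_filter a0 aU !orbT.
  - by case: (circle_real (U1 aU) a0) => ->; rewrite eqxx ?orbT.
move=> /or4P[/eqP->//|/eqP->//||]; first by rewrite mem_filter => /andP[].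
by move=> /mapP[b]; rewrite mem_filter => /andP[_ bU] ->; exact: UJ.
Qed.

Lemma half_sub_union : {subset H <= E}.
Proof.
move=> a; rewrite !inE !mem_cat => /or4P[/eqP->|/eqP->||->//].
- by rewrite one_U orbT.
- by rewrite mone_U orbT.
by rewrite mem_filter => /andP[_ ->]; rewrite orbT.
Qed.

Lemma half_uniq : uniq H.
Proof.
have := perm_half_split; move/perm_uniq; rewrite uU => /esym.
rewrite -!cat_cons cat_uniq => /and3P[u _ _].
rewrite /H /half_nodes -!cat_cons cat_uniq u uC andbT /=; apply/hasPn => a aC.
apply: contra (CU aC) => aP; rewrite (perm_mem perm_half_split) -!cat_cons mem_cat aP //.
Qed.

(** Counting each node of [half_nodes] with its conjugate, the real points 1 and
    -1 are counted twice. *)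
Lemma half_conj : perm_eq (H ++ [seq conjc a | a <- H])
                          (1 :: -1 :: E ++ [seq conjc a | a <- C]).
Proof.
rewrite /H /half_nodes !map_cons map_cat rmorph1 rmorphN1 /E.
set Pj := map _ P; set Cj := map _ C.
have PU := perm_half_split; rewrite -/Pj in PU.
rewrite !perm_cons -catA.
apply: (@perm_trans _ (C ++ (1 :: -1 :: P ++ Pj) ++ Cj)); last first.
  by rewrite perm_cat2l perm_cat2r perm_sym.
apply/permP => q; rewrite ?count_cat /= ?count_cat /= ?count_cat; ring.
Qed.

Lemma mem_half a : a \in H -> a \in C \/ a \in U /\ 0 <= complex.Im a.
Proof.
rewrite !inE mem_cat => /or4P[/eqP->|/eqP->||]; last by left.
- by right; rewrite one_U Im_1.
- by right; rewrite mone_U Im_N1.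
by rewrite mem_filter => /andP[a0 ->]; right; rewrite ltW.
Qed.

Lemma half_Re_inj : {in H &, injective (@complex.Re R)}.
Proof.
move=> a b aH bH.
move=> /(circle_Re (union_circle (half_sub_union aH)) (union_circle (half_sub_union bH))).
case=> // e; apply/eqP; rewrite {1}e conjc_fix; apply/eqP.
have [bC|[bU b0]] := mem_half bH.
  have [aC|[aU _]] := mem_half aH; first by have := CJ bC; rewrite -e aC.
  by have := CU bC; rewrite -[b]conjcK -e UJ.
have [aC|[aU a0]] := mem_half aH; first by have := CU aC; rewrite e UJ.
by apply/eqP; rewrite eq_le b0 andbT -oppr_ge0 -Im_conjc -e.
Qed.

Lemma size_half : (size H).*2 = (size U + 2 + (size C).*2)%N.
Proof.
by have /perm_size := perm_half_split; clear uC; rewrite /= !size_cat size_map; lia.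
Qed.

Lemma union_Re_half a : a \in E -> exists2 h, h \in H & complex.Re h = complex.Re a.
Proof.
rewrite mem_cat => /orP[aC|].
  by exists a => //; rewrite !inE mem_cat aC !orbT.
rewrite (perm_mem perm_half_split) -!cat_cons mem_cat => /orP[aP|/mapP[b bP ->]].
  by exists a => //; rewrite /H /half_nodes -!cat_cons mem_cat aP.
by exists b; rewrite ?Re_conjc// !inE mem_cat bP !orbT.
Qed.

(* Products over the nodes other than [h]: [G] over [half_nodes], each node
   contributing with its conjugate, and [O] over [C ++ U]. *)
Let G h z := nodal_abs (rem h H) z * nodal_abs (rem h H) (conjc z).
Let O h z := nodal_abs (rem h E) z.

Lemma half_rem h : h \in H ->
  perm_eq (conjc h :: (rem h H ++ [seq conjc a | a <- rem h H]))
          (1 :: -1 :: rem h E ++ [seq conjc a | a <- C]).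
Proof.
move=> hH; apply: (perm_rem_map (s1 := [:: 1; -1]) half_conj) => //.
exact: half_sub_union.
Qed.

Lemma half_rem_prod h z : h \in H ->
  normc (z - conjc h) * G h z =
  normc (z - 1) * normc (z + 1) * (O h z * nodal_abs C (conjc z)).
Proof.
move=> hH; have := nodal_abs_perm z (half_rem hH).
by rewrite !nodal_abs_cons !nodal_abs_cat !nodal_abs_conj opprK => ->; rewrite mulrA.
Qed.

(** For a real node, [half_rem_prod] gives no information at [z = h]; there the
    node and its conjugate coincide and cancel against 1 or -1 in the list. *)
Lemma half_rem_prod_real h z : h \in H -> conjc h = h ->
  G h z = normc (z + h) * (O h z * nodal_abs C (conjc z)).
Proof.
move=> hH hh; have h1 := union_circle (half_sub_union hH).
have p : perm_eq (1 :: -1 :: rem h E ++ [seq conjc a | a <- C])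
                 (h :: - h :: rem h E ++ [seq conjc a | a <- C]).
  have h0 : complex.Im h = 0 by apply/eqP; rewrite -conjc_fix hh.
  have [->|->] := circle_real h1 h0; rewrite ?opprK//.
  by rewrite -[1 :: -1 :: _]/([:: 1; -1] ++ _) -[-1 :: 1 :: _]/([:: -1; 1] ++ _) perm_cat2r
    -[[:: 1; -1]]/([:: 1] ++ [:: -1]) perm_catC.
have := perm_trans (half_rem hH) p; rewrite hh perm_cons => /(nodal_abs_perm z).
by rewrite nodal_abs_cons !nodal_abs_cat !nodal_abs_conj opprK.
Qed.

Lemma nodal_abs_U_conj z : nodal_abs U (conjc z) = nodal_abs U z.
Proof.
rewrite -nodal_abs_conj; apply: nodal_abs_perm; apply: perm_of_sub => //.
- by rewrite map_inj_uniq//; exact: conjcI.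
- by move=> _ /mapP[a aU ->]; exact: UJ.
- by rewrite size_map.
Qed.

Lemma rem_prod h z : h \in E -> normc (z - h) * O h z = nodal_abs C z * nodal_abs U z.
Proof.
move=> hE; rewrite -nodal_abs_cons -(nodal_abs_perm z (perm_to_rem hE)).
exact: nodal_abs_cat.
Qed.

Lemma rem_prod_gt0 h : 0 < O h h.
Proof. by apply: nodal_abs_gt0; rewrite mem_rem_uniqF// union_uniq. Qed.

Lemma nodal_abs_C_conj_gt0 h : h \in E -> 0 < nodal_abs C (conjc h).
Proof.
move=> hE; apply: nodal_abs_gt0; move: hE; rewrite mem_cat => /orP[/CJ//|/UJ hU].
by apply: contraTN hU => /CU.
Qed.

(** By [half_rem_prod] and [normc_sqrB1], up to the factor
    [|z - conj z| / |z - conj h|] the left-hand side is the first term. Since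
    [|z - conj z| <= |z - conj h| + |z - h|], the excess is that term times
    [|z - h| / |z - conj h|]; exchanging [z] and its conjugate in
    [rem_prod] identifies it with the second term. *)
Lemma half_ratio h z : h \in H -> normc z = 1 ->
  G h z / G h h <= (O h z / O h h) * (nodal_abs C (conjc z) / nodal_abs C (conjc h)) +
                   (O h (conjc z) / O h h) * (nodal_abs C z / nodal_abs C (conjc h)).
Proof.
move=> hH z1; have hE := half_sub_union hH; have h1 := union_circle hE.
have O0 := rem_prod_gt0 h; have C0 := nodal_abs_C_conj_gt0 hE.
set Oh := O h h in O0 *; set Ch := nodal_abs C (conjc h) in C0 *.
rewrite !mulf_div -mulrDl.
have OC0 : 0 < Oh * Ch by rewrite mulr_gt0.
(* For [h = 1] and [h = -1] the first term alone is enough, because [G h h] is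
   twice its generic value. *)
have [hh|hh] := eqVneq (conjc h) h.
  have -> : G h h = 2 * (Oh * Ch) by rewrite half_rem_prod_real// normc_double.
  rewrite half_rem_prod_real// -mulf_div.
  apply: (@le_trans _ _ (O h z * nodal_abs C (conjc z) / (Oh * Ch))).
    apply: ler_piMl; first by rewrite divr_ge0 ?mulr_ge0 ?nodal_abs_ge0// ltW.
    by rewrite ler_pdivrMr// mul1r; apply: le_trans (ler_normcD _ _) _; rewrite z1 h1.
  by rewrite ler_wpM2r ?invr_ge0 ?(ltW OC0)// lerDl mulr_ge0 ?nodal_abs_ge0.
have hJ : normc (h - conjc h) != 0 by rewrite normc_eq0 subr_eq0 eq_sym.
have -> : G h h = Oh * Ch.
  apply: (mulfI hJ); rewrite half_rem_prod// normc_sqrB1 //.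
rewrite ler_pM2r ?invr_gt0//.
(* At [z = conjc h] the common factor [z - conjc h] vanishes, but [G] is
   invariant under conjugation of [z]. *)
have [zh|zh] := eqVneq z (conjc h).
  have Gh : G h h = Oh * Ch.
    apply: (mulfI hJ); rewrite half_rem_prod// normc_sqrB1 //.
  have -> : G h z = G h h by rewrite /G zh conjcK mulrC.
  rewrite Gh zh conjcK -/Oh -/Ch lerDr mulr_ge0 ?nodal_abs_ge0//.
have zh0 : 0 < normc (z - conjc h) by rewrite normc_gt0 subr_eq0.
rewrite -(ler_pM2l zh0) half_rem_prod// normc_sqrB1// mulrDr.
have e2 : normc (z - conjc h) * (O h (conjc z) * nodal_abs C z) =
          normc (z - h) * (O h z * nodal_abs C (conjc z)).
  by rewrite normc_conj_sub !mulrA !rem_prod// nodal_abs_U_conj; ring.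
rewrite e2 -mulrDl ler_wpM2r ?mulr_ge0 ?nodal_abs_ge0//.
rewrite (_ : z - conjc z = (z - conjc h) - conjc (z - h)); last first.
  by rewrite rmorphB /=; ring.
by apply: le_trans (ler_normcB _ _) _; rewrite normc_conj.
Qed.

Lemma lag_Re h z : h \in H -> normc z = 1 ->
  lag [seq (complex.Re a)%:C | a <- H] (complex.Re h)%:C (complex.Re z)%:C
  = G h z / G h h.
Proof.
move=> hH z1; have h1 := union_circle (half_sub_union hH).
rewrite /G -mulf_div !nodal_abs_ratio (rem_filter h half_uniq) !big_filter -big_split.
rewrite /lag big_map big_seq_cond [RHS]big_seq_cond.
apply: eq_big => [a|a /andP[aH _]].
  apply: andb_id2l => aH /=; congr (~~ _); apply/eqP/eqP => [|->//].
  by move=> /complexI; exact: half_Re_inj.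
have a1 := union_circle (half_sub_union aH).
rewrite !Re_dist// [RHS]mulf_div.
set q := normc (h - a) * _; set q' := normc (z - a) * _.
have [->|q0] := eqVneq q 0; first by rewrite mul0r !invr0 !mulr0.
by field.
Qed.

Lemma real_lebesgue_le z : normc z = 1 ->
  \sum_(d <- [seq (complex.Re a)%:C | a <- H])
    lag [seq (complex.Re a)%:C | a <- H] d (complex.Re z)%:C <=
  \sum_(b <- E) lag E b z * (nodal_abs C (conjc z) / nodal_abs C (conjc b)) +
  \sum_(b <- E) lag E b (conjc z) * (nodal_abs C z / nodal_abs C (conjc b)).
Proof.
move=> z1; rewrite big_map -big_split /=.
apply: (@le_trans _ _ (\sum_(b <- H) (lag E b z * (nodal_abs C (conjc z) / nodal_abs C (conjc b)) +
   lag E b (conjc z) * (nodal_abs C z / nodal_abs C (conjc b))))).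
  rewrite big_seq [leRHS]big_seq; apply: ler_sum => h hH.
  by rewrite lag_Re// !lag_rem ?union_uniq// half_ratio.
apply: ler_sum_sub; [exact: half_uniq|exact: union_uniq|exact: half_sub_union|].
have nn b y (u v : R) : 0 <= u -> 0 <= v -> 0 <= lag E b y * (u / v).
  by move=> u0 v0; rewrite mulr_ge0 ?lag_ge0 ?divr_ge0.
by move=> b; apply: addr_ge0; apply: nn; exact: nodal_abs_ge0.
Qed.

End Projection.

(** * Sequences of projections *)

Section Projections.
Variable R : realType.
Implicit Types (e : nat -> R[i]) (r : nat -> R).

Lemma projects_to_prefix (e : nat -> R[i]) J (r : nat -> R) : projects_to e J r ->
  forall i j, (j <= J i)%N -> complex.Re (e j) \in mkseq r i.+1.
Proof.
move=> [J0 rE Jlt Jmin]; elim=> [|i IH] j.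
  by rewrite J0 leqn0 => /eqP ->; rewrite /= inE rE J0.
move=> jJ; have [/IH|ji] := leqP j (J i).
  by rewrite /mkseq => /mapP[q qi ->]; apply: map_f; move: qi; rewrite !mem_iota /=; lia.
have [h|h] := boolP (complex.Re (e j) \in mkseq r i.+1).
  by move: h => /mapP[q qi ->]; apply: map_f; move: qi; rewrite !mem_iota /=; lia.
have -> : j = J i.+1 by apply/eqP; rewrite eqn_leq jJ Jmin.
by rewrite -rE; apply: map_f; rewrite mem_iota /=; lia.
Qed.

Lemma projects_to_uniq (e : nat -> R[i]) J (r : nat -> R) : projects_to e J r ->
  forall k, uniq (mkseq r k).
Proof.
move=> [J0 rE Jlt Jmin]; elim=> [//|[//|k] IH].
by rewrite mkseqS rcons_uniq IH andbT rE; have [] := Jlt k.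
Qed.

(** If the real parts of the first [K] points form a list [S] of distinct
    values, then [r] enumerates [S] before reaching any other point: were
    [J] to exceed [K] earlier, all of [S] would lie among fewer than [size S]
    values. *)
Lemma projects_to_perm (e : nat -> R[i]) J (r : nat -> R) K (S : seq R) :
  projects_to e J r -> uniq S -> (1 < size S)%N ->
  S =i [seq complex.Re (e j) | j <- iota 0 K] ->
  perm_eq (mkseq r (size S)) S.
Proof.
move=> pJ uS S1 SE; have ur := projects_to_uniq pJ; have pre := projects_to_prefix pJ.
have [J0 rE Jlt Jmin] := pJ.
case sS : (size S) S1 => [//|[//|k]] _.
have Jmono i j : (i <= j)%N -> (J i <= J j)%N.
  elim: j => [|j IH]; first by rewrite leqn0 => /eqP ->.
  rewrite leq_eqVlt => /orP[/eqP -> //|]; rewrite ltnS => /IH h.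
  by apply: leq_trans h (ltnW _); have [] := Jlt j.
have JK : (J k.+1 < K)%N.
  rewrite ltnNge; apply/negP => KJ.
  have : (size S <= size (mkseq r k.+1))%N.
    apply: uniq_leq_size => // d; rewrite SE => /mapP[j]; rewrite mem_iota /= add0n => jK ->.
    have [/pre//|Jj] := leqP j (J k).
    apply: contraT => /(Jmin _ _ Jj); lia.
  by rewrite size_mkseq sS ltnn.
have sub : {subset mkseq r k.+2 <= S}.
  move=> a /mapP[q]; rewrite mem_iota /= add0n => qk ->; rewrite SE rE.
  apply: (map_f (fun j => complex.Re (e j))); rewrite mem_iota /= add0n.
  by apply: leq_ltn_trans JK; apply: Jmono.
by apply: perm_of_sub => //; rewrite size_mkseq sS.
Qed.

End Projections.

Theorem theorem3p2 (R : realType) (r : nat -> R) (n k : nat) :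
  Re_leja r ->
  (2 ^ n < k - 1)%N -> (k - 1 < 2 ^ n.+1)%N ->
  let l := (k - (2 ^ n + 1))%N in
  lebesgue_Re r k <=
    6 * Num.sqrt 5 * 2 ^+ (n + sigma1 l - two_val l) *
    lebesgue_unity R (2 ^ two_val l).
Proof.
move=> [e [J [eL pJ]]] kl ku; cbv zeta; set l := (k - _)%N.
have l0 : (0 < l)%N by rewrite /l; lia.
have ln : (l < 2 ^ n)%N by move: ku; rewrite expnS /l; lia.
have kE : k = (2 ^ n + 1 + l)%N by rewrite /l; lia.
clearbody l; subst k => {kl ku}.
set p := two_val l; have [bs bsE nE] := digits_two_val l0 ln.
rewrite -/p in bsE nE.
have sE : sigma1 l = (count id bs).+1.
  by rewrite -(count_digits ln) bsE count_cat count_nseq /= mul0n add0n add1n.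
set K := (2 ^ n.+1 + l)%N; set c := e K.
have cN : c ^+ (2 ^ n.+1) = -1 by exact: leja_pow.
have c1 : normc c = 1 by exact: leja_circle.
have PE := leja_nodes_top eL ln; rewrite -/K -/c cN opprK in PE.
set D := digits n l in bsE PE; set C := nodes D c in PE.
set U := roots2 n.+1 1 in PE.
(* [c ^ N] is a square root of -1, so conjugation moves the coset that contains
   [C] to the opposite one, away from [C]. *)
have dd : c ^+ (2 ^ n) * c ^+ (2 ^ n) = -1 by rewrite -expr2 -exprM mulnC -expnS.
have CN a : a \in C -> a ^+ (2 ^ n) = c ^+ (2 ^ n).
  by move=> aC; have := nodes_pow c1 aC; rewrite size_digits.
have uC : uniq C by exact: nodes_uniq.
have uU : uniq U by rewrite roots2_uniq// oner_neq0.
have C1 : {in C, forall a, normc a = 1} by exact: nodes_circle.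
have U1 : {in U, forall a, normc a = 1} by apply: roots2_circle; exact: normc1.
have CU : {in C, forall a, a \notin U}.
  move=> a /CN aN; rewrite mem_roots2 expnS mulnC exprM aN expr2 dd eq_sym.
  exact: one_neqN1.
have CJ : {in C, forall a, conjc a \notin C}.
  move=> a aC; apply/negP => /CN; rewrite -rmorphXn /= (CN _ aC) => h.
  have := one_neqN1 R; rewrite -dd -{1}h conjc_circle; last first.
    by rewrite normc_exp c1 expr1n.
  by rewrite mulVf ?eqxx// expf_neq0// circle_neq0.
have UJ : {in U, forall a, conjc a \in U}.
  move=> a; rewrite !mem_roots2 -rmorphXn /= => /eqP ->; by rewrite rmorph1.
have oneU : 1 \in U by rewrite mem_roots2 expr1n.
have moneU : -1 \in U by rewrite mem_roots2 expnS exprM sqrrN !expr1n.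
set H := half_nodes C U.
have uRe : uniq [seq complex.Re h | h <- H].
  by rewrite map_inj_in_uniq ?half_uniq//; exact: half_Re_inj.
have szH : size H = (2 ^ n + 1 + l)%N.
  have := size_half C uU U1 UJ oneU moneU; rewrite -/H size_roots2 size_nodes//.
  by rewrite expnS; lia.
have PR : perm_eq (mkseq r (2 ^ n + 1 + l)) [seq complex.Re h | h <- H].
  rewrite -szH -(size_map (@complex.Re R) H).
  apply: (projects_to_perm (K := K) pJ) => //.
  have CU_E a : (a \in C ++ U) = (a \in mkseq e K) by rewrite (perm_mem PE).
  move=> d; apply/mapP/mapP => [[h hH ->]|[j jK ->]].
    have := half_sub_union oneU moneU hH; rewrite CU_E => /mapP[j jK ->].
    by exists j.
  have : e j \in C ++ U by rewrite CU_E; exact: map_f.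
  by move=> /(union_Re_half uU U1 UJ oneU moneU)[h hH hE]; exists h.
have PS : perm_eq [seq x%:C | x <- mkseq r (2 ^ n + 1 + l)]
                  [seq (complex.Re h)%:C | h <- H].
  by have := perm_map (real_complex R) PR; rewrite -[map _ (map _ H)]map_comp.
have uS : uniq [seq x%:C | x <- mkseq r (2 ^ n + 1 + l)].
  by rewrite map_inj_uniq ?(projects_to_uniq pJ)//; exact: complexI.
have prC z : nodal_abs C z = normc (nodal D z c) by rewrite /nodal_abs prod_nodes.
set L := lebesgue_unity R (2 ^ p).
have bound z w : normc z = 1 -> normc w = 1 ->
    \sum_(b <- C ++ U) lag (C ++ U) b z * (nodal_abs C w / nodal_abs C (conjc b)) <=
    L * (22 * 2 ^+ (size bs + count id bs)).
  move=> z1 w1; have := @weighted_sum R p bs c z w c1; rewrite -bsE size_digits.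
  move=> /(_ cN z1 w1); rewrite nodes_rcons nodes_rcons0 size_rcons size_digits cN opprK.
  by under [X in _ -> X <= _]eq_bigr do rewrite !prC.
have L0 : 0 <= L by exact: lebesgue_unity_ge0.
(* The exponent [n + sigma1 l - p] exceeds [size bs + count id bs] by 2, so the
   claim is [44 <= 24 * Num.sqrt 5], and [Num.sqrt 5 >= 2] is enough. *)
have fin : L * (22 * 2 ^+ (size bs + count id bs)) +
    L * (22 * 2 ^+ (size bs + count id bs)) <=
    6 * Num.sqrt 5 * 2 ^+ (n + sigma1 l - p) * L.
  rewrite (_ : (n + sigma1 l - p)%N = (size bs + count id bs).+2); last by lia.
  set X := 2 ^+ (size bs + _); rewrite !exprS -/X.
  have X0 : 0 <= X by rewrite exprn_ge0.
  have s5 : 2 <= Num.sqrt 5 :> R.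
    rewrite -[leLHS]ger0_norm// -sqrtr_sqr ler_wsqrtr//.
    by rewrite -natrX ler_nat.
  rewrite -subr_ge0 (_ : _ - _ = (24 * (Num.sqrt 5 - 2) + 4) * (X * L)); last by ring.
  by rewrite mulr_ge0 ?mulr_ge0//; lra.
apply: ge_sup.
  by exists (\sum_(j < size [seq x%:C | x <- mkseq r (2 ^ n + 1 + l)])
    normc (lagrange j 0)), 0 => //; exists 0 => //=; rewrite in_itv /=; lra.
move=> _ [_ [x xI <-] <-]; rewrite sum_lagrange//.
have {xI} x1 : -1 <= x <= 1 by move: xI; rewrite /= in_itv.
set z := x +i* Num.sqrt (1 - x ^+ 2).
have z1 : normc z = 1.
  apply/eqP; rewrite -sqrp_eq1 ?normc_ge0// normcE2 /= sqr_sqrtr; last by nra.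
  by rewrite addrC subrK.
apply: le_trans fin.
rewrite (perm_big _ PS) /=; under eq_bigr do rewrite (lag_perm _ _ PS).
apply: le_trans (real_lebesgue_le uC uU C1 U1 CU CJ UJ oneU moneU z1) _.
by apply: lerD; apply: bound; rewrite ?normc_conj.
Qed.
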